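(* As $\lambda\to+\infty$, the process $(\lambda^2\overline{d}_\lambda(t))_{t\in[0,2\pi]}$ converges in law in the Skorohod space $D([0,2\pi])$ to the process $(X_t)_{t\in[0,2\pi]}$ defined, for every $i\in\{1,\ldots,N_e\}$ and every $t\in[\theta_i,\theta_{i+1})$, by $$X_t=-\frac{\Upsilon_i^2}{2R_i}\,\frac{\cos\bigl(2(\Theta_i-t)\bigr)}{\cos^3(\Theta_i-t)}.$$
   Context: Let $\mu$ be a probability measure on $\mathbb{R}_+$ with $\int R\,\mathrm{d}\mu(R)=1$, $\int R^2\,\mathrm{d}\mu(R)<+\infty$ and $\mu((R_\star,+\infty))=1$ for some $R_\star>0$. Let $\mathbf{Z}$ be a Poisson point process on $\mathbb{R}_+\times[0,2\pi)\times\mathbb{R}_+$ with intensity measure $\mathrm{d}\rho\,\mathrm{d}\theta\,\mathrm{d}\mu(R)$. To each $(\rho,\theta,R)\in\mathbf{Z}$ associate the line $D_{\rho,\theta}=\{x\in\mathbb{R}^2:\ x_1\cos\theta+x_2\sin\theta=\rho\}$. The Crofton cell $\mathcal{C}$ is the closed (almost surely bounded) convex polygon containing $0$ which is the closure of the connected component containing $0$ of the complement of the union of these lines. It has $N_e$ vertices, listed anti-clockwise as $V_1,\ldots,V_{N_e}$, with polar angles $0\le\theta_1<\cdots<\theta_{N_e}<2\pi$. Edge $i$ joins $V_i$ (included) to $V_{i+1}$ (excluded), indices being cyclic; $(\Upsilon_i,\Theta_i,R_i)\in\mathbf{Z}$ is the marked point whose line supports edge $i$ (distance to the origin, polar angle,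 associated radius). The interval $[\theta_{N_e},\theta_1)$ is understood cyclically modulo $2\pi$, and processes indexed by $t\in[0,2\pi)$ are extended to $t=2\pi$ by $2\pi$-periodicity. For $t\in[\theta_i,\theta_{i+1})$ put $\Upsilon(t)=\Upsilon_i$, $\Theta(t)=\Theta_i$, $R(t)=R_i$, so that the half-line $\Delta_t$ from $0$ in direction $t$ meets $\partial\mathcal{C}$ on edge $i$, at distance $\Upsilon(t)/\cos(\Theta(t)-t)$ from $0$. With $\psi_\lambda(\rho,R)=R\sqrt{1+2\rho/(\lambda^2R)}$, the approximate defect at angle $t$ is the distance from $0$ to the intersection of $\Delta_t$ with the disc of radius $\lambda^2R(t)$ whose centre has polar coordinates $(\lambda^2\psi_\lambda(\Upsilon(t),R(t)),\Theta(t))$, minus the distance from $0$ to $\Delta_t\cap\partial\mathcal{C}$; explicitly, $$\overline{d}_\lambda(t)=\lambda^2R(t)\cos(\Theta(t)-t)\sqrt{1+\tfrac{2\Upsilon(t)}{\lambda^2R(t)}}-\lambda^2R(t)\sqrt{1-\sin^2(\Theta(t)-t)\Bigl(1+\tfrac{2\Upsilon(t)}{\lambda^2R(t)}\Bigr)}-\frac{\Upsilon(t)}{\cos(\Theta(t)-t)},$$ which is well defined for $\lambda\ge\sqrt{2\Upsilon(t)\tan^2(\Theta(t)-t)/R(t)}$. On the event (of probability tending to $0$ as $\lambda\to+\infty$) where it is not defined for all $t$, the process $\lambda^2\overline{d}_\lambda$ is taken to be an arbitrary fixed element of $D([0,2\pi])$. *)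

(* Defs.v *)
From HB Require Import structures.
From mathcomp Require Import all_boot all_order all_algebra.
From mathcomp Require Import all_classical all_reals all_analysis.
From mathcomp Require Import measurable_realfun.

Set Implicit Arguments.
Unset Strict Implicit.
Unset Printing Implicit Defensive.

Import Order.TTheory GRing.Theory Num.Theory numFieldNormedType.Exports.

Local Open Scope classical_set_scope.
Local Open Scope ring_scope.

Section skorohod_space.
Context {R : realType} (a b : R).
Implicit Types (s t e : R) (x h : R -> R).

Definition cadlag x : Prop :=
  (forall t, a <= t < b -> x s @[s --> t^'+] --> x t) /\
  (forall t, a < t <= b -> cvg (x s @[s --> t^'-])).

Definition time_change h : Prop :=
  [/\ {in `[a, b] &, {homo h : s t / s < t}},
      h @` `[a, b] = `[a, b]%classic &
      {within `[a, b], continuous h}].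

(* A path on [a, b] is encoded by the function on R that extends it by 0, so
   that equality of elements is equality of functions on [a, b]. *)
Record skorohod := Skorohod {
  sko_fun :> R -> R ;
  sko_cadlag : cadlag sko_fun ;
  sko_out : forall t, t \notin `[a, b] -> sko_fun t = 0 }.

Lemma time_changeP h : {in `[a, b] &, {homo h : s t / s < t}} ->
  h @` `[a, b] = `[a, b]%classic -> time_change h.
Proof.
move=> inc surj; split => //.
have [ab|ba] := leP a b; last first.
  by rewrite set_itv_ge -?ltNge//; exact: continuous_subspace0.
have le_mono := le_mono_in inc.
have maps s : s \in `[a, b] -> h s \in `[a, b].
  by move=> sab; have : (h @` `[a, b]) (h s) by [exists s]; rewrite surj.
have onto s : s \in `[a, b] -> exists2 t, t \in `[a, b] & h t = s.
  move=> sab; have : `[a, b]%classic s by exact: sab.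
    by rewrite -surj => -[t ? ?]; exists t.
have [aab bab] : a \in `[a, b] /\ b \in `[a, b] by rewrite !in_itv/= !lexx ab.
have ha : h a = a.
  have [t tab ta] := onto _ aab; apply/eqP; rewrite eq_le.
  have /itvP -> := maps _ aab; rewrite andbT -[leRHS]ta le_mono//.
  by rewrite (itvP tab).
have hb : h b = b.
  have [t tab tb] := onto _ bab; apply/eqP; rewrite eq_le.
  have /itvP -> := maps _ bab; rewrite -[leLHS]tb le_mono//.
  by rewrite (itvP tab).
apply: segment_inc_surj_continuous => //; rewrite ha hb.
by move=> s /onto[t tab <-]; exists t.
Qed.

Lemma time_change_id : time_change id.
Proof. by apply: time_changeP => //; rewrite image_id. Qed.

Lemma time_change_comp h1 h2 :
  time_change h1 -> time_change h2 -> time_change (h1 \o h2).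
Proof.
move=> [i1 s1 _] [i2 s2 _].
have maps s : s \in `[a, b] -> h2 s \in `[a, b].
  by move=> sab; have : (h2 @` `[a, b]) (h2 s) by [exists s]; rewrite s2.
apply: time_changeP; last by rewrite -image_comp s2 s1.
by move=> s t sab tab st; apply: i1; rewrite ?maps//; exact: i2.
Qed.

Lemma time_change_maps h s : time_change h -> s \in `[a, b] -> h s \in `[a, b].
Proof.
by move=> [_ sh _] sab; have : (h @` `[a, b]) (h s) by [exists s]; rewrite sh.
Qed.

Lemma time_change_inv h : time_change h ->
  exists2 g, time_change g & {in `[a, b], cancel g h}.
Proof.
move=> hT; have [inc surj _] := hT.
have /choice[g gP] : forall s, exists t, s \in `[a, b] -> t \in `[a, b] /\ h t = s.
  move=> s; have [sab|] := boolP (s \in `[a, b]); last by exists 0.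
  have : `[a, b]%classic s by exact: sab.
  by rewrite -surj => -[t tab <-]; exists t.
have hK s : s \in `[a, b] -> g (h s) = s.
  move=> sab; have [gab ghs] := gP _ (time_change_maps hT sab).
  exact: (inc_inj_in (le_mono_in inc)).
exists g; last by move=> s /gP[].
apply: time_changeP => [s t sab tab st|].
  have [gs hgs] := gP _ sab; have [gt hgt] := gP _ tab.
  by rewrite -(leW_mono_in (le_mono_in inc))// hgs hgt.
apply/seteqP; split=> [_ [s sab <-]|s sab]; first exact: (gP _ sab).1.
by exists (h s); rewrite ?hK//; exact: time_change_maps.
Qed.

HB.instance Definition _ := gen_eqMixin skorohod.
HB.instance Definition _ := gen_choiceMixin skorohod.

Lemma cadlag0 : cadlag (cst 0).
Proof.
by split=> t _; [exact: cvg_cst|apply/cvg_ex; exists 0; exact: cvg_cst].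
Qed.

HB.instance Definition _ := isPointed.Build skorohod
  (Skorohod cadlag0 (fun _ _ => erefl)).

(* y is in the open ball of radius e about x for the Skorohod J1 distance
   d(x, y) = inf_h max(sup_t |h t - t|, sup_t |x t - y (h t)|). *)
Definition sko_ball (x : skorohod) e (y : skorohod) : Prop :=
  exists h, time_change h /\ exists2 e', e' < e &
    0 <= e' /\
    forall t, t \in `[a, b] -> `|h t - t| <= e' /\ `|x t - y (h t)| <= e'.

Definition sko_ent : set_system (skorohod * skorohod) := entourage_ sko_ball.

HB.instance Definition _ := hasNbhs.Build skorohod (nbhs_ sko_ent).

Lemma sko_ball_center (x : skorohod) e : 0 < e -> sko_ball x e x.
Proof.
move=> e0; exists id; split; first exact: time_change_id.
by exists 0 => //; split=> // t _; rewrite !subrr normr0.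
Qed.

Lemma sko_ball_sym (x y : skorohod) e : sko_ball x e y -> sko_ball y e x.
Proof.
move=> [h [hT [e' e'e [e'0 hP]]]]; have [g gT gK] := time_change_inv hT.
exists g; split=> //; exists e' => //; split=> // t tab.
have := hP _ (time_change_maps gT tab); rewrite gK//.
by rewrite distrC (distrC (x _)).
Qed.

Lemma sko_ball_triangle (x y z : skorohod) e1 e2 :
  sko_ball x e1 y -> sko_ball y e2 z -> sko_ball x (e1 + e2) z.
Proof.
move=> [h1 [h1T [e1' e1e [e10 h1P]]]] [h2 [h2T [e2' e2e [e20 h2P]]]].
exists (h2 \o h1); split; first exact: time_change_comp.
exists (e1' + e2'); first exact: ltrD.
split=> [|t tab /=]; first exact: addr_ge0.
have [A B] := h1P _ tab.
have [C D] := h2P _ (time_change_maps h1T tab).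
split; last by rewrite (le_trans (ler_distD (y (h1 t)) _ _))// lerD.
by rewrite (le_trans (ler_distD (h1 t) _ _))// addrC lerD.
Qed.

HB.instance Definition _ := Nbhs_isPseudoMetric.Build R skorohod
  erefl sko_ball_center sko_ball_sym sko_ball_triangle erefl.

Lemma cadlag_extend0 x :
  cadlag x -> cadlag (fun t => if t \in `[a, b] then x t else 0).
Proof.
move=> [rc ll]; split=> t /andP[at_ tb].
  rewrite in_itv/= at_ (ltW tb)/=; apply: cvg_trans (rc t _); last first.
    by rewrite at_ tb.
  apply: near_eq_cvg; near=> s; rewrite in_itv/= ifT//.
  apply/andP; split; first by rewrite (le_trans at_)//; near: s; exact: nbhs_right_ge.
  by near: s; exact: nbhs_right_le.
have /ll/cvg_ex[l xl] : a < t <= b by rewrite at_ tb.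
apply/cvg_ex; exists l; apply: cvg_trans xl.
apply: near_eq_cvg; near=> s; rewrite in_itv/= ifT//.
apply/andP; split; first by near: s; exact: nbhs_left_ge.
by rewrite (le_trans _ tb)//; near: s; exact: nbhs_left_le.
Unshelve. all: by end_near. Qed.

End skorohod_space.

Definition skorohod_of {R : realType} (a b : R) (x0 : skorohod a b)
    (f : R -> R) : skorohod a b :=
  match pselect (cadlag a b f) with
  | left fc => Skorohod (cadlag_extend0 fc)
      (fun t (tab : t \notin `[a, b]) => ifN _ _ tab)
  | right _ => x0
  end.

Section convergence_in_law.
Context {R : realType} d (Omega : measurableType d) (P : probability Omega R).
Context {D : ptopologicalType}.
Implicit Types (X Y : Omega -> D) (f : D -> R).

Definition random_element X : Prop :=
  measurable_fun setT (X : Omega -> g_sigma_algebraType (@open D)).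

(* A D-valued map that is defined, or measurable, only outside a P-null event
   is identified with its Borel measurable modifications; all of them have the
   same law. *)
Definition modification X Y : Prop :=
  random_element Y /\ {ae P, forall w, Y w = X w}.

Definition cvg_in_law (X_ : R -> Omega -> D) X : Prop :=
  exists (Y_ : R -> Omega -> D) (Y : Omega -> D),
  [/\ forall lam, modification (X_ lam) (Y_ lam),
      modification X Y &
      forall f, continuous f -> (exists M, forall y, `|f y| <= M) ->
        ('E_P[f \o Y_ lam] @[lam --> +oo%R] --> 'E_P[f \o Y])%E].

End convergence_in_law.

Section poisson_point_process.
Context {R : realType} d (Omega : measurableType d) (P : probability Omega R).
Context d' (E : measurableType d').

Definition point_count (Z : Omega -> set E) (B : set E) (w : Omega) : \bar R :=
  counting (Z w `&` B).

(* The second argument of [poisson_prob] is a dummy. *)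
Definition poisson_point_process (Lambda : {measure set E -> \bar R})
    (Z : Omega -> set E) : Prop :=
  [/\ forall B, measurable B -> measurable_fun setT (point_count Z B),
      forall B, measurable B -> (Lambda B < +oo)%E -> forall k : nat,
        P [set w | point_count Z B w = k%:R%:E] =
        poisson_prob (fine (Lambda B)) 0 [set k],
      forall B, measurable B -> Lambda B = +oo%E ->
        P [set w | point_count Z B w = +oo%E] = 1%E &
      forall n (B : 'I_n -> set E) (A : 'I_n -> set (\bar R)),
        (forall i, measurable (B i)) -> trivIset setT B ->
        (forall i, measurable (A i)) ->
        P (\bigcap_i (point_count Z (B i) @^-1` A i)) =
        (\prod_(i < n) P (point_count Z (B i) @^-1` A i))%E].

End poisson_point_process.

Section intensity.
Context {R : realType} (mu : probability R R).

(* A marked line is a triple ((rho, theta), r). *)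
Definition mark_space : set (R * R * R) :=
  [set z | [/\ 0 <= z.1.1, 0 <= z.1.2 < 2 * pi & 0 <= z.2]].

Lemma measurable_mark_space : measurable mark_space.
Proof.
rewrite (_ : mark_space = (`[0, +oo[ `*` `[0, 2 * pi[) `*` `[0, +oo[).
  by repeat apply: measurableX => //; exact: measurable_itv.
apply/seteqP; split=> -[[r t] u] /=; rewrite /mark_space/= !in_itv/= !andbT.
  by move=> [-> -> ->].
by move=> [[-> ->] ->].
Qed.

Definition intensity : set (R * R * R) -> \bar R := fun B =>
  ((lebesgue_measure \x lebesgue_measure) \x mu)%E (B `&` mark_space).

Let m := mrestr (((lebesgue_measure \x lebesgue_measure) \x mu)%E :
    {measure set (measurableTypeR R * measurableTypeR R * R) -> \bar R})
  measurable_mark_space.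

Let intensity0 : intensity set0 = 0%E.
Proof. exact: (measure0 m). Qed.

Let intensity_ge0 A : (0 <= intensity A)%E.
Proof. exact: (measure_ge0 m). Qed.

Let intensity_semi_sigma_additive : semi_sigma_additive intensity.
Proof. exact: (@measure_semi_sigma_additive _ _ _ m). Qed.

HB.instance Definition _ := isMeasure.Build _ _ _ intensity
  intensity0 intensity_ge0 intensity_semi_sigma_additive.

End intensity.

Section crofton_cell.
Context {R : realType}.
Implicit Types (Z : set (R * R * R)) (C : set (R * R)) (t : R).

Definition line (rho theta : R) : set (R * R) :=
  [set x | x.1 * cos theta + x.2 * sin theta = rho].

Definition crofton_cell Z : set (R * R) :=
  closure (connected_component
    (~` \bigcup_(z in Z) line z.1.1 z.1.2) (0 : R * R)).

Definition extreme_points C : set (R * R) :=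
  [set x | C x /\ forall y z (s : R), C y -> C z -> 0 < s < 1 ->
    x = (1 - s) *: y + s *: z -> y = z].

Definition half_open_segment (v w : R * R) : set (R * R) :=
  [set (1 - s) *: v + s *: w | s in `[0, 1[].

(* Indices run over {0, ..., nb_vertices - 1}; ordS is the cyclic successor. *)
Record labelling := Labelling {
  nb_vertices : nat ;
  vertex : 'I_nb_vertices -> R * R ;
  angle : 'I_nb_vertices -> R ;
  edge_mark : 'I_nb_vertices -> R * R * R }.

Definition labels Z (L : labelling) : Prop :=
  [/\ bounded_set (crofton_cell Z),
      range (@vertex L) = extreme_points (crofton_cell Z),
      forall i : 'I_(nb_vertices L), 0 <= angle i < 2 * pi /\
        exists2 r, 0 < r & vertex i = (r * cos (angle i), r * sin (angle i)),
      forall i j : 'I_(nb_vertices L), (i < j)%N -> angle i < angle j &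
      forall i : 'I_(nb_vertices L), Z (edge_mark i) /\
        half_open_segment (vertex i) (vertex (ordS i)) `<=`
        line (edge_mark i).1.1 (edge_mark i).1.2].

Definition labelling_of Z : labelling :=
  match pselect (exists L, labels Z L) with
  | left ZL => projT1 (cid ZL)
  | right _ => @Labelling 0 (fun=> 0) (fun=> 0) (fun=> 0)
  end.

(* t \in [theta_i, theta_{i+1}) for t in [0, 2 pi); the second branch is the
   interval that wraps around 2 pi. *)
Definition in_arc (L : labelling) (i : 'I_(nb_vertices L)) t : bool :=
  if angle i < angle (ordS i) then angle i <= t < angle (ordS i)
  else (angle i <= t) || (t < angle (ordS i)).

Definition mark_at Z t : R * R * R :=
  if [pick i : 'I_(nb_vertices (labelling_of Z)) | in_arc i t] is Some i
  then edge_mark i else 0.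

Definition Upsilon Z t : R := (mark_at Z t).1.1.
Definition Theta Z t : R := (mark_at Z t).1.2.
Definition Radius Z t : R := (mark_at Z t).2.

End crofton_cell.

Section defect.
Context {R : realType}.
Implicit Types (Z : set (R * R * R)) (lam t : R).

Definition defect Z lam t : R :=
  let u := Upsilon Z t in
  let phi := Theta Z t - t in
  let r := Radius Z t in
  lam ^+ 2 * r * cos phi * Num.sqrt (1 + 2 * u / (lam ^+ 2 * r))
  - lam ^+ 2 * r *
      Num.sqrt (1 - sin phi ^+ 2 * (1 + 2 * u / (lam ^+ 2 * r)))
  - u / cos phi.

Definition defect_defined Z lam : Prop :=
  [/\ exists L, labels Z L, 0 < lam &
      forall t, 0 <= t < 2 * pi ->
        Num.sqrt (2 * Upsilon Z t * tan (Theta Z t - t) ^+ 2 / Radius Z t)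
          <= lam].

Definition periodize (f : R -> R) t : R := f (if t == 2 * pi then 0 else t).

Definition scaled_defect (x0 : skorohod 0 (2 * pi : R)) lam Z :
    skorohod 0 (2 * pi) :=
  if pselect (defect_defined Z lam)
  then skorohod_of x0 (periodize (fun t => lam ^+ 2 * defect Z lam t))
  else x0.

Definition limit_process Z : skorohod 0 (2 * pi) :=
  skorohod_of point (periodize (fun t =>
    let u := Upsilon Z t in
    let phi := Theta Z t - t in
    let r := Radius Z t in
    - (u ^+ 2 / (2 * r)) * (cos (2 * phi) / cos phi ^+ 3))).

End defect.

(* Main.v *)
Require Import Defs.
From HB Require Import structures.
From mathcomp Require Import all_boot all_order all_algebra.
From mathcomp Require Import all_classical all_reals all_analysis.
From mathcomp Require Import measurable_realfun.
From mathcomp Require Import ring lra.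

(** The marks matter only through the line that is met first in each direction.
   In direction [t] the line of a mark [z] is at distance [1 / gauge z t] with
   [gauge z t = cos (theta - t) / rho], so the boundary of the cell is carried in
   direction [t] by the marks of largest gauge, here called active. Two gauges
   are distinct sinusoids, hence agree at isolated directions only. Therefore a
   configuration which is locally finite, has a line in each of eight equal
   sectors and has no two points at the same distance determines a bounded
   polygon: its vertices are the directions with two active marks, and exactly
   one mark is active strictly between two consecutive vertices. This gives the
   existence of a labelling ([labels_ex]) and shows that in any labelling the
   mark read at [t] is active, constant to the right of [t], and constant to the
   left of [t] ([mark_at_active], [mark_at_right], [mark_at_left]). Such
   configurations have probability one ([ae_generic]).

   For a fixed configuration only finitely many marks are active, so the
   distances are bounded, the radii are at least [Rs] and the cosines are bounded
   away from [0], uniformly in [t]. The second order expansion of both square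
   roots in [2 u / (lam ^ 2 r)] then gives uniform convergence of the rescaled
   defect to the limit, with an error of order [lam ^ -2] ([skorohod_cvg]). Almost
   sure convergence in the Skorohod space gives convergence in law by dominated
   convergence ([cvg_expectation]).

   Measurability is the remaining point. Evaluations generate the Borel sets of
   the J1 topology, because a cadlag path is the J1 limit of its discretisations
   ([measurable_skorohod]); so it is enough that the mark read in a fixed
   direction is measurable. That a mark of a given set is active is an event
   written with countably many point counts ([active_inP]), and right-continuity
   resolves the ties ([measurable_mark_at]). *)

Set Implicit Arguments.
Unset Strict Implicit.
Unset Printing Implicit Defensive.

Import Order.TTheory GRing.Theory Num.Theory numFieldNormedType.Exports.

Local Open Scope classical_set_scope.
Local Open Scope ring_scope.

(** * Discretisation of cadlag paths for the J1 distance *)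

Section skorohod_discretisation.
Context {R : realType} (a b : R).
Hypothesis ab : a < b.
Implicit Types (x : R -> R) (c s t u e : R) (n : nat).

Definition mesh n : R := (b - a) / n.+1%:R.

Lemma mesh_gt0 n : 0 < mesh n.
Proof. by rewrite divr_gt0// subr_gt0. Qed.

Lemma mesh_cvg0 e : 0 < e -> exists N, forall n, (N <= n)%N -> mesh n < e.
Proof.
move=> e0; exists (Num.truncn ((b - a) / e)) => n Nn.
rewrite /mesh ltr_pdivrMr// mulrC -ltr_pdivrMr//.
rewrite (lt_le_trans (truncnS_gt _))// ler_nat ltnS//.
Qed.

Definition cell_index n t : nat := Num.truncn ((t - a) / mesh n).

Lemma cell_indexP n t k : a <= t ->
  cell_index n t = k <-> a + k%:R * mesh n <= t < a + k.+1%:R * mesh n.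
Proof.
move=> at_; have d0 := mesh_gt0 n.
have t0 : 0 <= (t - a) / mesh n by rewrite divr_ge0 ?subr_ge0// ltW.
have E : (a + k%:R * mesh n <= t < a + k.+1%:R * mesh n) =
  (k%:R <= (t - a) / mesh n < k.+1%:R).
  by rewrite ler_pdivlMr// ltr_pdivrMr// lerBrDl ltrBlDl.
by rewrite E; split => [<-|]; [exact: truncn_itv|exact: truncn_def].
Qed.

Definition floor_grid n t : R := a + (cell_index n t)%:R * mesh n.

Lemma floor_grid_itv n t : a <= t -> floor_grid n t <= t < floor_grid n t + mesh n.
Proof.
move=> at_; have /cell_indexP := erefl (cell_index n t).
move=> /(_ at_) /andP[-> ] /=; rewrite /floor_grid.
by rewrite -natr1 mulrDl mul1r addrA.
Qed.

Lemma floor_grid_id n k : floor_grid n (a + k%:R * mesh n) = a + k%:R * mesh n.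
Proof.
have d0 := mesh_gt0 n.
have -> : floor_grid n (a + k%:R * mesh n) =
  a + (cell_index n (a + k%:R * mesh n))%:R * mesh n by [].
congr (_ + _ * _); congr (_%:R); apply/cell_indexP.
  by rewrite lerDl mulr_ge0// ltW.
by rewrite lexx/= ltrD2l ltr_pM2r// ltr_nat.
Qed.

Lemma end_grid n : b = a + n.+1%:R * mesh n.
Proof. by rewrite /mesh mulrC divfK// subrKC. Qed.

Lemma floor_grid_end n : floor_grid n b = b.
Proof. by rewrite [X in floor_grid _ X](end_grid n) floor_grid_id -end_grid. Qed.

Lemma cell_index_le n t : t <= b -> (cell_index n t <= n.+1)%N.
Proof.
move=> tb; have d0 := mesh_gt0 n.
have -> : n.+1 = cell_index n b.
  apply/esym/cell_indexP; first exact: ltW.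
  by rewrite -end_grid lexx/= {1}(end_grid n) ltrD2l ltr_pM2r// ltr_nat.
by apply: le_truncn; rewrite ler_pM2r ?invr_gt0// lerD2r.
Qed.

(** A jump at [c] is moved to the least grid point above [c], so that the grid
   points before the moved jump are exactly those before [c]. *)
Lemma ceil_grid_ex n c : a <= c <= b -> exists k,
  (a + k%:R * mesh n < c + mesh n) /\ c <= a + k%:R * mesh n <= b /\
  forall j, a + j%:R * mesh n < a + k%:R * mesh n -> a + j%:R * mesh n < c.
Proof.
move=> /andP[ac cb]; have d0 := mesh_gt0 n.
have ex : exists k, c <= a + k%:R * mesh n by exists n.+1; rewrite -end_grid.
case: (ex_minnP ex) => k ck kmin; exists k; split; last split.
- case: k ck kmin => [|k] ck kmin; first by rewrite mul0r addr0 ltr_pwDr.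
  rewrite -natr1 mulrDl mul1r addrA ltrD2r ltNge; apply/negP => /kmin.
  by rewrite ltnn.
- rewrite ck/= (end_grid n) lerD2l ler_pM2r// ler_nat kmin//.
  by rewrite -end_grid.
- move=> j; rewrite ltrD2l ltr_pM2r// ltr_nat => jk.
  by rewrite ltNge; apply/negP => /kmin; rewrite leqNgt jk.
Qed.

Lemma cadlag_step n (v : nat -> R) : cadlag a b (fun t => v (cell_index n t)).
Proof.
have d0 := mesh_gt0 n; split => t.
- move=> /andP[at_ tb].
  have /(cell_indexP n _ at_) /andP[l1 l2] := erefl (cell_index n t).
  apply: (@cvg_trans _ (cst (v (cell_index n t)) @ t^'+)).
    apply: near_eq_cvg; near=> s; rewrite /cst; congr v; apply/esym.
    have ts : t < s by near: s; exact: nbhs_right_gt.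
    apply/cell_indexP; first by rewrite (le_trans at_)// ltW.
    rewrite (le_trans l1 (ltW ts)) andTb; near: s; exact: nbhs_right_lt.
  exact: cvg_cst.
- move=> /andP[at_ tb].
  have [k [k1 [/andP[k2 k3] k4]]] : exists k,
    (a + k%:R * mesh n < t + mesh n) /\ t <= a + k%:R * mesh n <= b /\
  forall j, a + j%:R * mesh n < a + k%:R * mesh n -> a + j%:R * mesh n < t.
    by apply: ceil_grid_ex; rewrite (ltW at_).
  case: k k1 k2 k3 k4 => [|k] k1 k2 k3 k4.
    by move: k2; rewrite mul0r addr0 leNgt at_.
  apply/cvg_ex; exists (v k); apply: (@cvg_trans _ (cst (v k) @ t^'-)); last exact: cvg_cst.
  apply: near_eq_cvg; near=> s; rewrite /cst; congr v; apply/esym.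
  have st : s < t by near: s; exact: nbhs_left_lt.
  have as_ : a <= s by near: s; exact: nbhs_left_ge.
  apply/cell_indexP => //; rewrite (lt_le_trans st k2) andbT.
  near: s; apply: nbhs_left_ge; apply: k4.
  by rewrite ltrD2l ltr_pM2r// ltr_nat.
Unshelve. all: by end_near. Qed.

Definition step_path n (v : nat -> R) : skorohod a b :=
  Skorohod (cadlag_extend0 (cadlag_step n v)) (fun t tab => ifN _ _ tab).

Section approximation.
Variables (x : R -> R) (e : R).
Hypothesis e0 : 0 < e.

(** [h] maps [[a, c']] onto [[a, c]] and brings the discretised path within [e]
   of [x]; the end point is excluded from the last condition because the value
   there belongs to the next piece. *)
Definition straightens n c c' (h : R -> R) : Prop :=
  [/\ {in `[a, c'] &, {homo h : s t / s < t}},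
      forall t, a <= t <= c' -> a <= h t <= c,
      h c' = c,
      forall s, a <= s <= c -> exists2 t, a <= t <= c' & h t = s &
      forall t, a <= t <= c' -> `|h t - t| <= mesh n] /\
  forall t, a <= t < c' -> `|x (floor_grid n t) - x (h t)| <= e.

(** The time changes of all fine enough meshes, up to the grid point that replaces
   [c]. *)
Definition straightenable c : Prop :=
  exists2 d0 : R, 0 < d0 & forall n, mesh n < d0 ->
    forall k, a + k%:R * mesh n < c + mesh n -> c <= a + k%:R * mesh n <= b ->
    (forall j, a + j%:R * mesh n < a + k%:R * mesh n -> a + j%:R * mesh n < c) ->
    exists h, straightens n c (a + k%:R * mesh n) h.

Lemma straightenable_start : straightenable a.
Proof.
exists 1 => // n _ k ka ak _; have d0 := mesh_gt0 n.
have -> : k = 0%N.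
  by move: ka; rewrite ltrD2l gtr_pMl// -[ltRHS]/(1%:R) ltr_nat; case: k {ak}.
rewrite mul0r addr0; exists id; split; last by move=> t /andP[? ?]; lra.
split=> //; last by move=> t _; rewrite subrr normr0 ltW.
by move=> s ?; exists s.
Qed.

(** The new piece is affine, so its displacement interpolates those of its two
   ends, which are less than the mesh. On it both paths are read in [[c, d[],
   where [x] oscillates by at most [e]. *)
Lemma straightenable_step c d : a <= c -> c < d -> d <= b ->
  straightenable c ->
  (forall u v, c <= u < d -> c <= v < d -> `|x u - x v| <= e) ->
  straightenable d.
Proof.
move=> ac cd db [d0 d00 cP] osc.
exists (Num.min d0 (d - c)); first by rewrite lt_min d00 subr_gt0.
move=> n; rewrite lt_min => /andP[nd0 ndc] m m1 /andP[m2 m3] m4.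
have mn0 := mesh_gt0 n.
have [k [k1 [/andP[k2 k3] k4]]] : exists k,
    (a + k%:R * mesh n < c + mesh n) /\ c <= a + k%:R * mesh n <= b /\
  forall j, a + j%:R * mesh n < a + k%:R * mesh n -> a + j%:R * mesh n < c.
  by apply: ceil_grid_ex; rewrite ac/= (le_trans (ltW cd)).
have [h [[h1 h2 h3 h4 h5] h6]] := cP n nd0 k k1 (introT andP (conj k2 k3)) k4.
set c' := a + k%:R * mesh n in k1 k2 k3 k4 h1 h2 h3 h4 h5 h6 *.
set d' := a + m%:R * mesh n in m1 m2 m3 m4 *.
have c'd' : c' < d' by lra.
pose l t := c + (t - c') * ((d - c) / (d' - c')).
have r0 : 0 < (d - c) / (d' - c') by rewrite divr_gt0 ?subr_gt0.
have lc : l c' = c by rewrite /l subrr mul0r addr0.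
have ld : l d' = d by rewrite /l mulrC divfK ?gt_eqF ?subr_gt0//; lra.
have linc s t : s < t -> l s < l t.
  by move=> st; rewrite /l ltrD2l ltr_pM2r// ltrD2r.
have lle s t : s <= t -> l s <= l t.
  by move=> st; rewrite /l lerD2l ler_pM2r// lerD2r.
exists (fun t => if t <= c' then h t else l t); split; first split.
- move=> s t; rewrite !in_itv/= => /andP[as_ sd] /andP[at_ td] st.
  case: (leP s c') => sc; case: (leP t c') => tc.
  + by apply: h1 => //; rewrite in_itv/= ?as_ ?at_.
  + have /andP[_ hs] := h2 s (introT andP (conj as_ sc)).
    by rewrite (le_lt_trans hs)// -[ltLHS]lc; exact: linc.
  + lra.
  + exact: linc.
- move=> t /andP[at_ td]; case: (leP t c') => tc.
    have /andP[-> hs] := h2 t (introT andP (conj at_ tc)).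
    by rewrite (le_trans hs) ?ltW.
  have := lle _ _ (ltW tc); have := lle _ _ td; rewrite lc ld; lra.
- by case: (leP d' c') => //; lra.
- move=> s /andP[as_ sd]; have [sc|cs] := leP s c.
    have [t /andP[at_ tc] hts] := h4 s (introT andP (conj as_ sc)).
    by exists t; [lra|rewrite tc].
  pose t := c' + (s - c) * ((d' - c') / (d - c)).
  have t1 : c' < t by rewrite /t ltrDl mulr_gt0 ?divr_gt0 ?subr_gt0.
  have lt_ : l t = s by rewrite /l /t; field; lra.
  exists t.
    have [|td'] := leP t d'; first by rewrite (le_trans _ (ltW t1)) ?andbT//; lra.
    by have := linc _ _ td'; rewrite ld lt_; lra.
  by rewrite leNgt t1/=.
- move=> t /andP[at_ td]; case: (leP t c') => tc; first by apply: h5; rewrite at_.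
  have -> : l t - t = (c - c') * ((d' - t) / (d' - c')) + (d - d') * ((t - c') / (d' - c')).
    by rewrite /l; field; lra.
  have q1 : 0 <= (d' - t) / (d' - c') by rewrite divr_ge0; lra.
  have q2 : 0 <= (t - c') / (d' - c') by rewrite divr_ge0; lra.
  have q3 : (d' - t) / (d' - c') + (t - c') / (d' - c') = 1 by field; lra.
  rewrite (le_trans (ler_normD _ _))// (normrM (c - c')) (normrM (d - d')) (ger0_norm q1) (ger0_norm q2).
  rewrite -[leRHS]mulr1 -q3 mulrDr lerD// ler_wpM2r// ler_norml; lra.
- move=> t /andP[at_ td]; case: (leP t c') => tc.
    move: tc; rewrite le_eqVlt => /orP[/eqP tc|tc]; last by apply: h6; rewrite at_.
    rewrite tc h3 floor_grid_id; apply: osc; last by rewrite lexx.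
    by rewrite k2/= m4.
  apply: osc; last first.
    apply/andP; split; first by rewrite -[leLHS]lc lle// ltW.
    by rewrite -[ltRHS]ld linc.
  have /andP[f1 f2] := floor_grid_itv n at_.
  apply/andP; split; last by apply: m4; apply: le_lt_trans td.
  rewrite (le_trans k2)// /floor_grid lerD2l ler_pM2r// ler_nat -ltnS.
  rewrite -(ltr_nat R) -(ltr_pM2r mn0) -(ltrD2l a) (lt_trans tc)//.
  by move: f2; rewrite /floor_grid -natr1 mulrDl mul1r addrA.
Qed.

End approximation.
End skorohod_discretisation.
Section skorohod_approximation.
Context {R : realType} (a b : R).
Hypothesis ab : a < b.
Implicit Types (c s t u e : R) (n : nat).

(** Left limits make the set of straightenable points closed from the left, and
   right-continuity extends it to the right of each of its points. *)
Lemma straightenable_end (x : R -> R) e : cadlag a b x -> 0 < e ->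
  straightenable a b x e b.
Proof.
move=> [rc ll] e0.
pose A := [set c | a <= c <= b /\ straightenable a b x e c].
have Aa : A a by split; [rewrite lexx ltW|exact: straightenable_start].
have ubA : ubound A b by move=> c [/andP[]].
have supA : has_sup A by split; [exists a|exists b].
have as_ : a <= sup A by apply: ub_le_sup => //; exists b.
have sb : sup A <= b by apply: ge_sup => //; exists a.
have As : A (sup A).
  have [<-//|sa] := eqVneq a (sup A).
  have {}sa : a < sup A by rewrite lt_neqAle sa.
  have /ll/cvg_ex[l /cvgrPdist_lt/(_ (e / 2))] : a < sup A <= b by rewrite sa.
  move=> /(_ (divr_gt0 e0 (ltr0n _ 2))) [r/= r0 rP].
  have [c Ac cs] := sup_adherent r0 supA.
  have cs' : c <= sup A by apply: ub_le_sup => //; exists b.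
  have [<-//|cs''] := eqVneq c (sup A).
  have {cs' cs''} cs' : c < sup A by rewrite lt_neqAle cs''.
  split; first by rewrite as_.
  have [/andP[ac cb] cP] := Ac.
  apply: (straightenable_step ab ac cs' sb cP) => u v uP vP.
  have P w : c <= w < sup A -> `|l - x w| < e / 2.
    move=> /andP[cw ws]; apply: rP => //=.
    by rewrite gtr0_norm ?subr_gt0//; lra.
  have := P _ uP; have := P _ vP; rewrite !ltr_norml ler_norml; lra.
have [E|sb'] := eqVneq (sup A) b; first by have := As.2; rewrite E.
have {sb} {}sb : sup A < b by rewrite lt_neqAle sb'.
have /rc/cvgrPdist_lt/(_ (e / 2)) : a <= sup A < b by rewrite as_.
move=> /(_ (divr_gt0 e0 (ltr0n _ 2))) [r/= r0 rP].
pose d := Num.min (sup A + r) b.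
have sd : sup A < d by rewrite lt_min sb ltrDl r0.
have db : d <= b by rewrite ge_min lexx orbT.
have dr : d <= sup A + r by rewrite ge_min lexx.
suff Ad : A d by move: sd; rewrite ltNge ub_le_sup//; exists b.
split; first by rewrite db andbT (le_trans as_ (ltW sd)).
apply: (straightenable_step ab as_ sd db As.2) => u v uP vP.
have P w : sup A <= w < d -> `|x (sup A) - x w| < e / 2.
  move=> /andP[]; rewrite le_eqVlt => /orP[/eqP<- _|sw wd].
    by rewrite subrr normr0 divr_gt0.
  by apply: rP => //=; rewrite ltr0_norm ?subr_lt0//; lra.
have := P _ uP; have := P _ vP; rewrite !ltr_norml ler_norml; lra.
Qed.

(** Discretising a cadlag path in time converges for the J1 distance (not
   uniformly): a time change moves each jump to the next grid point. *)
Lemma step_path_ball (x : skorohod a b) e : 0 < e -> exists N, forall n,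
  (N <= n)%N -> forall v : nat -> R,
  (forall k, (k <= n.+1)%N -> `|v k - x (a + k%:R * mesh a b n)| <= e) ->
  sko_ball x (3 * e) (step_path ab n v).
Proof.
move=> e0; have [d0 d00 dP] := straightenable_end (sko_cadlag x) e0.
have [|N NP] := @mesh_cvg0 _ a b (Num.min d0 e); first by rewrite lt_min d00.
exists N => n Nn v vP; have := NP n Nn; rewrite lt_min => /andP[nd0 ne].
have mn0 := mesh_gt0 ab n; have eg := end_grid a b n.
have [] := dP n nd0 n.+1; rewrite -?eg ?lexx ?ltrDl//.
move=> h [[h1 h2 h3 h4 h5] h6].
apply: sko_ball_sym; exists h; split.
  apply: time_changeP => //; apply/seteqP; split => [_ [t tab <-]|s sab].
    by rewrite /= in_itv/= h2//; move: tab; rewrite /= in_itv.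
  have [|t tab <-] := h4 s; first by move: sab; rewrite /= in_itv.
  by exists t => //=; rewrite in_itv.
exists (2 * e); first by rewrite ltr_pM2r// ltr_nat.
split; first by rewrite mulr_ge0// ltW.
move=> t tab; have := tab; rewrite in_itv/= => /andP[at_ tb].
split; first by rewrite (le_trans (h5 t _)) ?at_//; lra.
rewrite /step_path/= tab.
have V := vP _ (cell_index_le ab n tb).
have X : `|x (floor_grid a b n t) - x (h t)| <= e.
  move: tb; rewrite le_eqVlt => /orP[/eqP ->|tb]; last by rewrite h6// at_.
  by rewrite floor_grid_end// h3 subrr normr0 ltW.
move: V X; rewrite -/(floor_grid a b n t) !ler_norml; lra.
Qed.

End skorohod_approximation.

(** * Borel sets of the Skorohod space *)

Lemma eq_skorohod {R : realType} (a b : R) (x y : skorohod a b) :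
  (forall t, x t = y t) -> x = y.
Proof.
case: x y => x xD x0 [y yD y0] /= /funext xy; case: _ / xy in yD y0 *.
by congr Skorohod; exact: Prop_irrelevance.
Qed.

(** The limit is in the open set [U] iff, for some radius, the balls of that
   radius around the approximations are inside [U] from some rank on. *)
Lemma measurable_preimage_limit {R : realType} d (T : measurableType d)
    (D : pseudoMetricType R) (Y_ : nat -> T -> D) (Y : T -> D) :
  (forall n (U : set D), measurable (Y_ n @^-1` U)) ->
  (forall w, Y_ n w @[n --> \oo] --> Y w) ->
  forall U, open U -> measurable (Y @^-1` U).
Proof.
move=> mY cY U oU.
pose V k := [set x : D | ball x k.+1%:R^-1 `<=` U].
have -> : Y @^-1` U =
  \bigcup_k \bigcup_N \bigcap_(n in [set n | (N <= n)%N]) (Y_ n @^-1` V k).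
  apply/seteqP; split => w.
  - move=> /= Uw; have : nbhs (Y w) U by exact: open_nbhs_nbhs.
    rewrite -nbhs_ballE => -[e/= e0 eU].
    pose k := Num.truncn (2 / e).
    have ke : k.+1%:R^-1 < e / 2.
      rewrite -[ltRHS]invrK ltf_pV2 ?posrE ?invr_gt0 ?divr_gt0//.
      by rewrite invf_div truncnS_gt.
    exists k => //.
    have : \forall n \near \oo, ball (Y w) (e / 2) (Y_ n w).
      by apply: cY; apply: nbhsx_ballx; rewrite divr_gt0.
    move=> [N _ NP]; exists N => // n /= Nn z zP; apply: eU.
    have := ball_triangle (NP _ Nn) zP.
    by apply: le_ball; rewrite [leRHS]splitr lerD2l ltW.
  - move=> [k _ [N _ NP]] /=.
    have : \forall n \near \oo, ball (Y w) k.+1%:R^-1 (Y_ n w).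
      by apply: cY; apply: nbhsx_ballx.
    move=> [M _ MP].
    apply: (NP (maxn N M)); first exact: leq_maxl.
    by apply: ball_sym; apply: MP; exact: leq_maxr.
apply: bigcupT_measurable => k; apply: bigcupT_measurable => N.
by apply: bigcap_measurable => //; exists N => /=.
Qed.


Lemma eq_step_path {R : realType} (a b : R) (ab : a < b) n (v v' : nat -> R) :
  (forall k, (k <= n.+1)%N -> v k = v' k) -> step_path ab n v = step_path ab n v'.
Proof.
move=> vv'; apply: eq_skorohod => t /=; case: ifP => //.
by rewrite in_itv/= => /andP[_ tb]; apply: vv'; exact: cell_index_le.
Qed.

(** Evaluations generate the Borel sigma-algebra of the J1 topology: a path is
   the limit of its discretisations in time and in value, and these are
   measurable maps into a countable set. *)
Lemma measurable_skorohod {R : realType} (a b : R) d (T : measurableType d)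
    (X : T -> skorohod a b) : a < b ->
  (forall t, a <= t <= b -> measurable_fun setT (fun w => X w t)) ->
  forall U : set (skorohod a b), open U -> measurable (X @^-1` U).
Proof.
move=> ab mX.
pose q n k (w : T) : int := Num.floor (n.+1%:R * X w (a + k%:R * mesh a b n)).
pose Y n w := step_path ab n (fun k => (q n k w)%:~R / n.+1%:R).
have mq n k : (k <= n.+1)%N -> forall i, measurable (q n k @^-1` [set i]).
  move=> kn i.
  have gab : a <= a + k%:R * mesh a b n <= b.
    have m0 := mesh_gt0 ab n; rewrite lerDl mulr_ge0 ?(ltW m0)//=.
    by rewrite [leRHS](end_grid a b n) lerD2l ler_pM2r// ler_nat.
  rewrite (_ : _ @^-1` _ = (fun w => n.+1%:R * X w (a + k%:R * mesh a b n)) @^-1`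
      `[i%:~R, (i + 1)%:~R[%classic); last first.
    apply/seteqP; split => w /=; rewrite /q in_itv/=.
      by move=> <-; exact: floor_itv.
    by move=> /floor_def.
  rewrite -[X in measurable X]setTI; apply: measurable_funM => //.
  exact: mX.
have mY n (U : set (skorohod a b)) : measurable (Y n @^-1` U).
  pose ext (f : {ffun 'I_n.+2 -> int}) (k : nat) : R :=
    (f (inord k))%:~R / n.+1%:R.
  pose S (f : {ffun 'I_n.+2 -> int}) : set T :=
    if `[< U (step_path ab n (ext f)) >] then
      \bigcap_(k in [set k | (k <= n.+1)%N]) (q n k @^-1` [set f (inord k)])
    else set0.
  rewrite (_ : _ @^-1` _ = \bigcup_f S f).
    apply: countable_bigcupT_measurable => [|f]; first exact: countableP.
    rewrite /S; case: ifP => // _; apply: bigcap_measurableType => k /= kn.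
    exact: mq.
  have YE w (f : {ffun 'I_n.+2 -> int}) : (forall k, (k <= n.+1)%N -> q n k w = f (inord k)) ->
      Y n w = step_path ab n (ext f).
    move=> wf; apply: eq_step_path => k kn.
    by rewrite /ext wf.
  apply/seteqP; split => w /=.
    pose f : {ffun 'I_n.+2 -> int} := [ffun k : 'I_n.+2 => q n k w].
    have wf k : (k <= n.+1)%N -> q n k w = f (inord k).
      by move=> kn; rewrite ffunE inordK.
    move=> Uw; exists f => //; rewrite /S ifT; last by rewrite asboolE -(YE w).
    by move=> k /= kn; exact: wf.
  move=> [f _]; rewrite /S; case: ifP => // /asboolP Uf wf.
  by rewrite (YE w f)// => k kn; exact: wf.
apply: measurable_preimage_limit mY _ => w.
apply/cvg_ballP => e e0.
have e4 : 0 < e / 4 by rewrite divr_gt0.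
have [N NP] := step_path_ball ab (X w) e4.
near=> n; have nN : (N <= n)%N by near: n; exists N.
have ne : n.+1%:R^-1 <= e / 4.
  rewrite ltW//; near: n; exact: near_infty_natSinv_lt (PosNum e4).
apply: (@le_ball _ _ _ (3 * (e / 4))); first lra.
apply: (NP _ nN) => k kn; rewrite (le_trans _ ne)// /q.
set y := X w _; have n0 : 0 < n.+1%:R :> R by [].
have /andP[f1 f2] := floor_itv (n.+1%:R * y).
rewrite (_ : _ - y = ((Num.floor (n.+1%:R * y))%:~R - n.+1%:R * y) / n.+1%:R).
  rewrite normrM [X in _ * X]gtr0_norm ?invr_gt0// ler_piMl ?invr_ge0//.
  by move: f1 f2; rewrite intrD ler_norml; lra.
by field; rewrite addrC natr1 lt0r_neq0.
Unshelve. all: by end_near. Qed.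
(** * Polar coordinates *)

Section polar_coordinates.
Context {R : realType}.
Implicit Types (x y t : R).

Lemma cos_2piD t : cos (2 * pi + t) = cos t.
Proof. by rewrite mulr_natl addrC cosD2pi. Qed.

Lemma sin_2piD t : sin (2 * pi + t) = sin t.
Proof. by rewrite mulr_natl addrC sinD2pi. Qed.

Lemma polar_coordinates x y : (x, y) != (0, 0) ->
  exists r t : R, [/\ 0 < r, 0 <= t < 2 * pi, x = r * cos t & y = r * sin t].
Proof.
move=> xy0; pose r : R := Num.sqrt (x ^+ 2 + y ^+ 2).
have s0 : 0 < x ^+ 2 + y ^+ 2.
  rewrite lt_neqAle addr_ge0 ?sqr_ge0// andbT eq_sym paddr_eq0 ?sqr_ge0//.
  by rewrite !sqrf_eq0; apply: contra xy0 => /andP[/eqP -> /eqP ->].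
have r0 : 0 < r by rewrite sqrtr_gt0.
have r2 : r ^+ 2 = x ^+ 2 + y ^+ 2 by rewrite sqr_sqrtr// ltW.
pose c := x / r.
have xE : x = r * c by rewrite /c mulrC divfK// gt_eqF.
have c2 : (r * Num.sqrt (1 - c ^+ 2)) ^+ 2 = y ^+ 2.
  have cE : r ^+ 2 * (1 - c ^+ 2) = y ^+ 2.
    by rewrite mulrBr mulr1 -exprMn -xE r2 addrAC subrr add0r.
  have c1 : 0 <= 1 - c ^+ 2.
    by rewrite -(pmulr_rge0 _ (exprn_gt0 2 r0)) cE sqr_ge0.
  by rewrite exprMn (sqr_sqrtr c1).
have c1 : -1 <= c <= 1.
  rewrite -ler_norml -(@ler_pXn2r _ 2)// ?nnegrE// expr1n -normrX.
  rewrite ger0_norm ?sqr_ge0// -(ler_pM2l (exprn_gt0 2 r0)) -exprMn -xE mulr1 r2.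
  by rewrite lerDl sqr_ge0.
have sy : r * Num.sqrt (1 - c ^+ 2) = `|y|.
  by rewrite -[RHS]sqrtr_sqr -c2 sqrtr_sqr ger0_norm// mulr_ge0// ?sqrtr_ge0// ltW.
have p0 := pi_gt0 R; have a0 := acos_ge0 c1; have ap := acos_lepi c1.
exists r; have [y0|y0] := leP 0 y.
  exists (acos c); rewrite acosK// sin_acos// sy ger0_norm//; split => //.
  by rewrite a0/=; lra.
exists (2 * pi - acos c); rewrite cos_2piD cosN sin_2piD sinN acosK// sin_acos//.
rewrite mulrN sy ltr0_norm// opprK; split => //.
have : 0 < acos c; last by lra.
apply: acos_gt0; case/andP: c1 => -> /=; rewrite le_eqVlt => /orP[/eqP c1|//].
by move: sy; rewrite c1 expr1n subrr sqrtr0 mulr0 ltr0_norm//; lra.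
Qed.

Lemma angle_reduction t :
  exists2 s : R, 0 <= s < 2 * pi & cos t = cos s /\ sin t = sin s.
Proof.
have [|r [s [r0 sP c1 s1]]] := @polar_coordinates (cos t) (sin t).
  apply/eqP => -[c0 s0]; have := cos2Dsin2 t.
  by rewrite c0 s0 expr0n/= addr0 => /eqP; rewrite eq_sym oner_eq0.
exists s => //; suff r1 : r = 1 by rewrite c1 s1 r1 !mul1r.
apply/eqP; rewrite -(@eqrXn2 _ 2)// ?ltW// expr1n -[X in _ == X](cos2Dsin2 t).
by rewrite c1 s1 !exprMn -mulrDr cos2Dsin2 mulr1.
Qed.

Lemma cos_sin_inj t s : 0 <= t < 2 * pi -> 0 <= s < 2 * pi ->
  cos t = cos s -> sin t = sin s -> t = s.
Proof.
have key (u v : R) : 0 <= u -> u <= v -> v < 2 * pi -> cos u = cos v ->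
    sin u = sin v -> u = v.
  move=> u0 uv v2 cuv suv.
  have c1 : cos (v - u) = 1 by rewrite cosB -cuv -suv -!expr2 cos2Dsin2.
  have p0 := pi_gt0 R.
  apply/eqP; rewrite eq_sym -subr_eq0; apply/eqP.
  have [vu|vu] := leP (v - u) pi.
    by apply: cos_inj; rewrite ?cos0// in_itv/=; lra.
  have : cos (2 * pi - (v - u)) = cos 0 by rewrite cos_2piD cosN c1 cos0.
  move=> /cos_inj; rewrite !in_itv/= => E.
  by have := E ltac:(lra) ltac:(lra); lra.
move=> /andP[t0 t1] /andP[s0 s1] c1 c2; have [ts|st] := leP t s.
  exact: key.
by apply/esym/key => //; rewrite ltW.
Qed.

End polar_coordinates.

(** * The lines met first from the origin *)

Section support_function.
Context {R : realType}.
Implicit Types (Z : set (R * R * R)) (z : R * R * R) (s t u v : R).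

(** The half-line of direction [t] meets the line of mark [z] at distance
   [1 / gauge z t] from the origin when [gauge z t > 0], and not at all
   otherwise; the cell boundary is therefore at distance the inverse of the
   largest gauge. *)
Definition gauge z t : R := cos (z.1.2 - t) / z.1.1.

(** The line of [z] carries the boundary of the cell in direction [t]. *)
Definition active Z t z : Prop := Z z /\ forall z', Z z' -> gauge z' t <= gauge z t.

(** Almost sure properties of the Poisson process. Eight sectors are enough to
   put a line at an angle less than [pi / 4] from any direction; distinct
   distances imply distinct lines and a single radius for each line. *)
Definition generic (Rs : R) Z : Prop :=
  [/\ forall z, Z z -> [/\ 0 < z.1.1, 0 <= z.1.2 < 2 * pi & Rs < z.2],
      forall M, finite_set [set z | Z z /\ z.1.1 <= M],
      forall k : nat, (k < 8)%N -> exists2 z, Z z &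
        k%:R * (pi / 4) <= z.1.2 < k.+1%:R * (pi / 4) &
      forall z z', Z z -> Z z' -> z.1.1 = z'.1.1 -> z = z'].

Lemma gaugeE z t :
  gauge z t = cos t * (cos z.1.2 / z.1.1) + sin t * (sin z.1.2 / z.1.1).
Proof. by rewrite /gauge cosB; ring. Qed.

Lemma continuous_gauge z : continuous (gauge z).
Proof.
move=> t; apply: cvgMr_tmp; apply: (@continuous_comp _ _ _ (fun s => z.1.2 - s) cos).
  by apply: cvgB; [exact: cvg_cst|exact: cvg_id].
exact: continuous_cos.
Qed.

Lemma near_forall_seq (T : Type) (I : eqType) (F : set_system T) {FF : Filter F}
    (l : seq I) (P : I -> T -> Prop) :
  (forall i, i \in l -> \forall x \near F, P i x) ->
  \forall x \near F, forall i, i \in l -> P i x.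
Proof.
elim: l => [_|i l IH Pl]; first by near=> x.
have Pi := Pl i (mem_head _ _).
have {}IH := IH (fun j jl => Pl j (mem_behead (s := i :: l) jl)).
near=> x => j; rewrite in_cons => /orP[/eqP ->|]; first by near: x.
by move: j; near: x.
Unshelve. all: by end_near. Qed.

Lemma argmax_seq (T : eqType) (f : T -> R) (l : seq T) i : i \in l ->
  exists2 j, j \in l & forall k, k \in l -> f k <= f j.
Proof.
elim: l i => // a l IH i _; case: l IH => [|b l] IH.
  by exists a; rewrite ?mem_head// => k; rewrite inE => /eqP ->.
have [j jl jmax] := IH b (mem_head _ _).
have [aj|ja] := leP (f a) (f j).
  exists j; first by rewrite in_cons jl orbT.
  by move=> k; rewrite in_cons => /orP[/eqP ->//|/jmax].
exists a; first by rewrite mem_head.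
move=> k; rewrite in_cons => /orP[/eqP ->//|/jmax kj].
by rewrite (le_trans kj)// ltW.
Qed.

Section generic_configuration.
Variables (Rs : R) (Z : set (R * R * R)).
Hypothesis ZG : generic Rs Z.

Lemma dist_gt0 z : Z z -> 0 < z.1.1.
Proof. by move=> Zz; have [/(_ _ Zz)[]] := ZG. Qed.

(** In each direction some line is crossed before a fixed distance, because
   every sector of opening [pi / 4] contains the polar angle of a line. *)
Lemma gauge_lower_bound : exists2 c : R, 0 < c &
  forall t, exists2 z, Z z & c <= gauge z t.
Proof.
have [_ _ G3 _] := ZG; have p0 := pi_gt0 R.
have /choice[z zP] : forall k : 'I_8, exists z, Z z /\
    k%:R * (pi / 4) <= z.1.2 < k.+1%:R * (pi / 4).
  by move=> k; have [z ? ?] := G3 k (ltn_ord k); exists z.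
pose M : R := \sum_(k < 8) (z k).1.1.
have Mz k : (z k).1.1 <= M.
  rewrite /M (bigD1 k)//= lerDl sumr_ge0// => j _.
  exact/ltW/dist_gt0/(zP j).1.
have M0 : 0 < M by apply: lt_le_trans (Mz ord0); exact: dist_gt0 (zP ord0).1.
have c0 : 0 < cos (pi / 4 : R) by apply: cos_gt0_pihalf; lra.
exists (cos (pi / 4) / M); first by rewrite divr_gt0.
move=> t; have [s /andP[s0 s2] [ct st]] := angle_reduction t.
have q0 : 0 < pi / 4 :> R by lra.
have /truncn_itv /andP[k1 k2] : 0 <= s / (pi / 4) by rewrite divr_ge0// ltW.
set k := Num.truncn _ in k1 k2.
have k8 : (k < 8)%N.
  rewrite -(ltr_nat R) (le_lt_trans k1)// ltr_pdivrMr//; lra.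
move: k1 k2; rewrite ler_pdivlMr// ltr_pdivrMr// => k1 k2.
have [Zz /andP[/= z1 z2]] := zP (Ordinal k8).
exists (z (Ordinal k8)) => //; rewrite /gauge cosB ct st -cosB.
have zpos := dist_gt0 Zz.
have C : cos (pi / 4) <= cos ((z (Ordinal k8)).1.2 - s).
  have kk : k.+1%:R = k%:R + 1 :> R by rewrite -natr1.
  have dd : `|(z (Ordinal k8)).1.2 - s| < pi / 4.
    by rewrite kk in k2 z2; rewrite ltr_norml; lra.
  rewrite -[leRHS]cos_norm ltW// ltr_cos ?in_itv//=; last by lra.
  by rewrite normr_ge0/=; lra.
rewrite ler_pM// ?invr_ge0 ?(ltW c0) ?(ltW M0)//.
by rewrite lef_pV2 ?posrE// Mz.
Qed.

(** A line farther than the inverse of the lower bound of the gauges is never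
   active. *)
Lemma finite_competitors : exists l : seq (R * R * R),
  [/\ forall z, z \in l -> Z z, forall t z, active Z t z -> z \in l &
      forall t z, Z z -> (forall z', z' \in l -> gauge z' t <= gauge z t) ->
        active Z t z].
Proof.
have [c c0 cP] := gauge_lower_bound.
have [_ /(_ c^-1)/finite_seqP[l lE] _ _] := ZG.
have lP z : z \in l <-> Z z /\ z.1.1 <= c^-1.
  split=> [zl|zP]; first by have : [set` l] z by []; rewrite -lE.
  by have : [set z | Z z /\ z.1.1 <= c^-1] z by []; rewrite lE.
have far z t : Z z -> c <= gauge z t -> z \in l.
  move=> Zz cz; apply/lP; split => //; have z0 := dist_gt0 Zz.
  rewrite -[leRHS]mul1r ler_pdivlMr// mulrC.
  move: cz; rewrite /gauge ler_pdivlMr// => /le_trans; apply; exact: cos_le1.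
exists l; split; first by move=> z /lP[].
  move=> t z [Zz zmax]; have [z' Zz' cz'] := cP t.
  by apply: (far _ t) => //; rewrite (le_trans cz') ?zmax.
move=> t z Zz zmax; split => // z' Zz'; have [z'' Zz'' cz''] := cP t.
have [cz'|cz'] := leP c (gauge z' t); first exact/zmax/(far _ t).
by rewrite (le_trans (ltW cz'))// (le_trans cz'')// zmax// (far _ t).
Qed.

Lemma active_ex t : exists z, active Z t z.
Proof.
have [l [l1 l2 l3]] := finite_competitors.
have [c c0 cP] := gauge_lower_bound.
have [z0 z0l] : exists z, z \in l.
  have [z Zz cz] := cP t; apply: contrapT => l0.
  have : active Z t z by apply: l3 => // z' z'l; case: l0; exists z'.
  by move=> /l2 zl; apply: l0; exists z.
have [z zl zmax] := argmax_seq (gauge^~ t) z0l.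
by exists z; apply: l3 => //; exact: l1.
Qed.

Lemma active_gauge_gt0 t z : active Z t z -> 0 < gauge z t.
Proof.
move=> [Zz zmax]; have [c c0 cP] := gauge_lower_bound.
by have [z' Zz' cz'] := cP t; rewrite (lt_le_trans c0)// (le_trans cz') ?zmax.
Qed.

Lemma active_cos_gt0 t z : active Z t z -> 0 < cos (z.1.2 - t).
Proof.
move=> zA; have := active_gauge_gt0 zA; rewrite /gauge pmulr_lgt0// invr_gt0.
exact: dist_gt0 zA.1.
Qed.

(** By continuity, each of the finitely many competitors which is not active at
   [t] stays below an active one. *)
Lemma active_near t : \forall s \near t, forall z, active Z s z -> active Z t z.
Proof.
have [l [l1 l2 l3]] := finite_competitors.
have [z0 z0A] := active_ex t.
have : \forall s \near t, forall z, z \in l -> ~ active Z t z ->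
    gauge z s < gauge z0 s.
  apply: (@near_forall_seq R _ (nbhs t) _ l
    (fun z s => ~ active Z t z -> gauge z s < gauge z0 s)) => z zl.
  have [zA|zA] := pselect (active Z t z); first by near=> s0.
  have zz0 : gauge z t < gauge z0 t.
    rewrite ltNge; apply/negP => z0z; apply: zA; split; first exact: l1.
    by move=> z' Zz'; rewrite (le_trans _ z0z)// z0A.2.
  have gc : (gauge z0 s - gauge z s) @[s --> t] --> gauge z0 t - gauge z t.
    by apply: cvgB; exact: continuous_gauge.
  have g0 : 0 < gauge z0 t - gauge z t by rewrite subr_gt0.
  by apply: filterS (cvgr_gt _ gc _ g0) => s + _; rewrite subr_gt0.
apply: filterS => s sP z zA; apply: contrapT => nzA.
by have := sP z (l2 _ _ zA) nzA; rewrite ltNge (zA.2 _ z0A.1).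
Unshelve. all: by end_near. Qed.

Lemma closed_active z : closed [set t | active Z t z].
Proof.
have -> : [set t | active Z t z] = [set t | Z z] `&`
    \bigcap_(z' in Z) ((fun t => gauge z t - gauge z' t) @^-1` [set x | 0 <= x]).
  apply/seteqP; split => t.
    by move=> [Zz zmax]; split => // z' Zz'/=; rewrite subr_ge0 zmax.
  by move=> [Zz zmax]; split => // z' /zmax/=; rewrite subr_ge0.
apply: closedI.
  have [Zz|Zz] := pselect (Z z).
    by rewrite (_ : [set _ | _] = setT) ?predeqE//; exact: closedT.
  by rewrite (_ : [set _ | _] = set0) ?predeqE//; exact: closed0.
apply: closed_bigI => z' Zz'; apply: preimage_closed; last exact: closed_ge.
by move=> t _; apply: cvgB; exact: continuous_gauge.
Qed.

(** Two lines have a single common point, so their gauges cannot agree in two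
   directions that are neither equal nor opposite. *)
Lemma gauge_inj z z' s t : Z z -> Z z' -> gauge z s = gauge z' s ->
  gauge z t = gauge z' t -> sin (t - s) != 0 -> z = z'.
Proof.
move=> Zz Zz' + + st; rewrite !gaugeE.
set a := cos z.1.2 / _; set b := sin z.1.2 / _.
set a' := cos z'.1.2 / _; set b' := sin z'.1.2 / _ => Es Et.
(* The two equations are a linear system of determinant [sin (t - s)]. *)
have aa' : a = a'.
  apply/eqP; rewrite -subr_eq0; apply/eqP; apply: (mulfI st); rewrite mulr0 sinB.
  transitivity (sin t * ((cos s * a + sin s * b) - (cos s * a' + sin s * b'))
    - sin s * ((cos t * a + sin t * b) - (cos t * a' + sin t * b'))); first by ring.
  by rewrite Es Et !subrr !mulr0 subrr.
have bb' : b = b'.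
  apply/eqP; rewrite -subr_eq0; apply/eqP; apply: (mulfI st); rewrite mulr0 sinB.
  transitivity (cos s * ((cos t * a + sin t * b) - (cos t * a' + sin t * b'))
    - cos t * ((cos s * a + sin s * b) - (cos s * a' + sin s * b'))); first by ring.
  by rewrite Es Et !subrr !mulr0 subrr.
have norm (w : R * R * R) :
    (cos w.1.2 / w.1.1) ^+ 2 + (sin w.1.2 / w.1.1) ^+ 2 = w.1.1 ^- 2.
  by rewrite !exprMn -mulrDl cos2Dsin2 mul1r exprVn.
have [_ _ _] := ZG; apply => //.
have : z.1.1 ^- 2 = z'.1.1 ^- 2 by rewrite -norm -/a -/b aa' bb' norm.
move=> /invr_inj /eqP; rewrite eqrXn2// ?ltW ?dist_gt0//; exact: eqP.
Qed.

Lemma gauge_inj_near z z' s t : Z z -> Z z' -> gauge z s = gauge z' s ->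
  gauge z t = gauge z' t -> s < t < s + pi -> z = z'.
Proof.
move=> Zz Zz' Es Et st; apply: (gauge_inj Zz Zz' Es Et).
by rewrite gt_eqF// sin_gt0_pi//; lra.
Qed.

Lemma active_eq_gauge t z z' : active Z t z -> active Z t z' -> gauge z t = gauge z' t.
Proof. by move=> [Zz zm] [Zz' zm']; apply/eqP; rewrite eq_le zm// zm'. Qed.

(** The directions of the vertices of the cell. *)
Definition corner t : Prop := exists z z', [/\ active Z t z, active Z t z' & z <> z'].

Lemma cornerN t z z' : ~ corner t -> active Z t z -> active Z t z' -> z = z'.
Proof. by move=> tN zA z'A; apply: contrapT => zz'; apply: tN; exists z, z'. Qed.

(** Between two corners the same line is active: being active is a closed
   condition, and without corner it is open too. *)
Lemma active_between u v : u < v -> (forall s, u < s < v -> ~ corner s) ->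
  exists2 z, Z z & forall s, u <= s <= v -> active Z s z.
Proof.
move=> uv nc; pose m := (u + v) / 2.
have um : u < m < v by rewrite /m; lra.
have [z zA] := active_ex m; exists z; first exact: zA.1.
have inside : forall s, u < s < v -> active Z s z.
  pose B := `]u, v[%classic `&` [set s | active Z s z].
  suff BE : B = `]u, v[%classic.
    by move=> s sP; have : `]u, v[%classic s by []; rewrite -BE => -[].
  have : connected `]u, v[%classic by apply/connected_intervalP; exact: interval_is_interval.
  apply.
  - by exists m.
  - exists [set s | forall z', active Z s z' -> z' = z].
      rewrite openE => s /= sz; rewrite /interior; have := active_near s.
      by apply: filterS => s' + z' z'A; move=> /(_ _ z'A) /sz.
    apply/seteqP; split => s [suv /=].
      by move=> sA; split => // z' /cornerN; apply => //; exact: nc.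
    have [z' z'A] := active_ex s; move=> /(_ _ z'A) E.
    by split => //=; rewrite -E.
  - by exists [set s | active Z s z] => //; exact: closed_active.
move=> s suv; have /nbhs_ballP[r/= r0 rP] := active_near s.
pose k := r / (r + (v - u)); have rvu : 0 < r + (v - u) by lra.
have k0 : 0 < k by rewrite divr_gt0.
have k1 : k < 1 by rewrite /k ltr_pdivrMr// mul1r ltrDl; lra.
have kr : k * (v - u) < r.
  by rewrite /k mulrAC ltr_pdivrMr// ltr_pM2l// ltrDr.
apply: (rP (s + k * (m - s))); last first.
  by apply: inside; apply/andP; split; nra.
rewrite /ball/= opprD addNKr normrN normrM gtr0_norm// (le_lt_trans _ kr)//.
by rewrite ler_pM2l// ler_norml; lra.
Qed.

End generic_configuration.
End support_function.
(** * The Crofton cell and its labellings *)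

Section corners.
Context {R : realType}.
Implicit Types (Z : set (R * R * R)) (z : R * R * R) (s t u v r : R).
Variables (Rs : R) (Z : set (R * R * R)).
Hypothesis ZG : generic Rs Z.

(** A line is seen from the origin under an angle less than [pi]. *)
Lemma active_short u v z : active Z u z -> (forall s, u <= s <= v -> active Z s z) ->
  v < u + pi.
Proof.
move=> zu zuv; rewrite ltNge; apply/negP => uv; have p0 := pi_gt0 R.
have zu' : active Z (u + pi) z by apply: zuv; lra.
have := active_cos_gt0 ZG zu'; have := active_cos_gt0 ZG zu.
have := cosDpi (z.1.2 - (u + pi)).
rewrite (_ : z.1.2 - (u + pi) + pi = z.1.2 - u); last by ring.
by move=> E c1 c2; lra.
Qed.

(** Lines active next to [t] are active at [t], and two of them cannot agree both
   at [t] and at a direction close to [t]. *)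
Lemma right_isolation t : exists2 z, active Z t z &
  \forall s \near t^'+, forall z', active Z s z' -> z' = z.
Proof.
have /nbhs_ballP[r/= r0 rP] := active_near ZG t; have p0 := pi_gt0 R.
pose e := Num.min r pi; have e0 : 0 < e by rewrite lt_min r0.
have [er ep] : e <= r /\ e <= pi by rewrite !ge_min !lexx orbT.
have nc s : t < s < t + e -> ~ corner Z s.
  move=> /andP[ts se] [z1 [z2 [z1A z2A z12]]].
  have tsb : ball t r s by rewrite /ball/= ltr0_norm ?subr_lt0//; lra.
  apply: z12; apply: (gauge_inj_near ZG z1A.1 z2A.1 (s := t) (t := s)); last by lra.
    exact: active_eq_gauge (rP _ tsb _ z1A) (rP _ tsb _ z2A).
  exact: active_eq_gauge z1A z2A.
have te : t < t + e by rewrite ltrDl.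
have [z Zz zA] := active_between ZG te nc.
exists z; first by apply: zA; lra.
near=> s => z' z'A.
have ts : t < s < t + e.
  by apply/andP; split; near: s; [exact: nbhs_right_gt|apply: nbhs_right_lt; lra].
apply: (cornerN (nc s ts) z'A); apply: zA; lra.
Unshelve. all: by end_near. Qed.

Lemma left_isolation t : exists2 z, active Z t z &
  \forall s \near t^'-, forall z', active Z s z' -> z' = z.
Proof.
have /nbhs_ballP[r/= r0 rP] := active_near ZG t; have p0 := pi_gt0 R.
pose e := Num.min r pi; have e0 : 0 < e by rewrite lt_min r0.
have [er ep] : e <= r /\ e <= pi by rewrite !ge_min !lexx orbT.
have nc s : t - e < s < t -> ~ corner Z s.
  move=> /andP[ts se] [z1 [z2 [z1A z2A z12]]].
  have tsb : ball t r s by rewrite /ball/= gtr0_norm ?subr_gt0//; lra.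
  apply: z12; apply: (gauge_inj_near ZG z1A.1 z2A.1 (s := s) (t := t)); last by lra.
    exact: active_eq_gauge z1A z2A.
  exact: active_eq_gauge (rP _ tsb _ z1A) (rP _ tsb _ z2A).
have te : t - e < t by rewrite gtrBl.
have [z Zz zA] := active_between ZG te nc.
exists z; first by apply: zA; lra.
near=> s => z' z'A.
have ts : t - e < s < t.
  by apply/andP; split; near: s; [apply: nbhs_left_gt; lra|exact: nbhs_left_lt].
apply: (cornerN (nc s ts) z'A); apply: zA; lra.
Unshelve. all: by end_near. Qed.

Lemma eq_gauge s t z : cos t = cos s -> sin t = sin s -> gauge z t = gauge z s.
Proof. by move=> ct st; rewrite !gaugeE ct st. Qed.

Lemma eq_active s t z : cos t = cos s -> sin t = sin s -> active Z t z -> active Z s z.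
Proof.
move=> ct st [Zz zm]; split => // z' Zz'.
by rewrite -!(eq_gauge _ ct st) zm.
Qed.

Lemma eq_corner s t : cos t = cos s -> sin t = sin s -> corner Z t -> corner Z s.
Proof.
by move=> ct st [z [z' [zA z'A ?]]]; exists z, z'; split => //; exact: eq_active ct st _.
Qed.

(** Otherwise a single line would be active in all directions. *)
Lemma ex_corner : exists2 t : R, 0 <= t < 2 * pi & corner Z t.
Proof.
have p0 := pi_gt0 R; apply: contrapT => nc.
have [|s sP|z Zz zA] := @active_between _ _ _ ZG 0 (2 * pi); first by lra.
  by move=> cs; apply: nc; exists s => //; lra.
have : 2 * pi < 0 + pi :> R by apply: (active_short (z := z)) => //; apply: zA; lra.
lra.
Qed.

(** A pair of lines is tied at most once per half turn, and finitely many lines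
   compete. *)
Lemma finite_corners : finite_set [set t : R | 0 <= t < 2 * pi /\ corner Z t].
Proof.
have [l [l1 l2 l3]] := finite_competitors ZG; have p0 := pi_gt0 R.
pose G z z' k := [set t | (k%:R * pi <= t < k.+1%:R * pi) /\
  [/\ Z z, Z z', z <> z' & gauge z t = gauge z' t]].
have finG z z' k : finite_set (G z z' k).
  have [[t tG]|G0] := pselect (exists t, G z z' k t); last first.
    by rewrite (_ : G _ _ _ = set0)// predeqE => t; split=> // tG; apply: G0; exists t.
  apply: (@sub_finite_set _ _ [set t]); last exact: finite_set1.
  have key u v : G z z' k u -> G z z' k v -> ~ (u < v).
    move=> [/andP[u1 u2] [Zz Zz' zz' Eu]] [/andP[v1 v2] [_ _ _ Ev]] uv.
    apply: zz'; apply: (gauge_inj_near ZG Zz Zz' Eu Ev).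
    by move: v2; rewrite -natr1 mulrDl mul1r; lra.
  move=> u uG /=; apply/eqP; rewrite eq_le !leNgt; apply/andP; split; apply/negP.
    exact: key.
  exact: key.
pose H := \bigcup_(z in [set` l]) \bigcup_(z' in [set` l]) (G z z' 0%N `|` G z z' 1%N).
apply: (@sub_finite_set _ _ H).
  move=> t [/andP[t0 t2] [z [z' [zA z'A zz']]]].
  exists z; first exact: l2 zA.
  exists z'; first exact: l2 z'A.
  have E := active_eq_gauge zA z'A; have [tp|pt] := ltP t pi; [left|right].
    by split; [rewrite mul0r mul1r t0|split; [exact: zA.1|exact: z'A.1| |]].
  by split; [rewrite mul1r pt|split; [exact: zA.1|exact: z'A.1| |]].
apply: bigcup_finite => [|z _]; first exact: finite_seq.
apply: bigcup_finite => [|z' _]; first exact: finite_seq.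
by rewrite finite_setU.
Qed.

(** The distance from the origin to the boundary of the cell. *)
Definition radial t : R := (gauge (get [set z | active Z t z]) t)^-1.

Lemma radialE t z : active Z t z -> radial t = (gauge z t)^-1.
Proof.
move=> zA; rewrite /radial (@active_eq_gauge _ Z t _ z)//.
by apply: (@getPex _ [set z | active Z t z]); exists z.
Qed.

Lemma radial_gt0 t : 0 < radial t.
Proof.
have [z zA] := active_ex ZG t.
by rewrite (radialE zA) invr_gt0 (active_gauge_gt0 ZG zA).
Qed.

Lemma radial_bounded : exists M : R, forall t, radial t <= M.
Proof.
have [c c0 cP] := gauge_lower_bound ZG; exists c^-1 => t.
have [z zA] := active_ex ZG t; have [z' Zz' cz'] := cP t.
have zc : c <= gauge z t by rewrite (le_trans cz')// zA.2.
by rewrite (radialE zA) lef_pV2// posrE// (lt_le_trans c0).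
Qed.

Definition polar r t : R * R := (r * cos t, r * sin t).

Definition boundary_point t : R * R := polar (radial t) t.

(** The line of [z] is the level [z.1.1] of this linear form. *)
Definition form z (x : R * R) : R := x.1 * cos z.1.2 + x.2 * sin z.1.2.

Lemma scale_pairE (p q : R) (x y : R * R) :
  p *: x + q *: y = (p * x.1 + q * y.1, p * x.2 + q * y.2).
Proof. by []. Qed.

Lemma form_lin z (x y : R * R) (p q : R) :
  form z (p *: x + q *: y) = p * form z x + q * form z y.
Proof. rewrite scale_pairE /form/=; ring. Qed.

Lemma form_polar z r t : Z z -> form z (polar r t) = (r * gauge z t) * z.1.1.
Proof.
move=> Zz; rewrite /form /gauge /polar cosB/=; field.
by rewrite gt_eqF// (dist_gt0 ZG).
Qed.

Lemma form_boundary z t : Z z -> form z (boundary_point t) = z.1.1 <-> active Z t z.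
Proof.
move=> Zz; have z0 := dist_gt0 ZG Zz; rewrite /boundary_point form_polar//.
have [z1 z1A] := active_ex ZG t; have g0 := active_gauge_gt0 ZG z1A.
rewrite (radialE z1A) -[X in _ = X]mul1r; split.
  move=> /(mulIf (lt0r_neq0 z0)) /(congr1 ( *%R (gauge z1 t))).
  rewrite mulVKf ?gt_eqF// mulr1 => zE; split => // z' Zz'.
  by rewrite zE z1A.2.
by move=> /(active_eq_gauge z1A) <-; rewrite mulVf ?gt_eqF// mul1r.
Qed.

Lemma polar_cell z r t : Z z -> 0 <= r <= radial t -> form z (polar r t) <= z.1.1.
Proof.
move=> Zz /andP[r0 rt]; have z0 := dist_gt0 ZG Zz.
rewrite form_polar// ger_pMl//; have [z1 z1A] := active_ex ZG t.
have g0 := active_gauge_gt0 ZG z1A.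
rewrite (le_trans (ler_wpM2l r0 (z1A.2 _ Zz)))// -ler_pdivlMr// mul1r.
by rewrite -(radialE z1A).
Qed.

Lemma cell_polar r t : (forall z, Z z -> form z (polar r t) <= z.1.1) -> r <= radial t.
Proof.
move=> rP; have [z zA] := active_ex ZG t; have g0 := active_gauge_gt0 ZG zA.
have := rP _ zA.1; rewrite (form_polar _ _ zA.1) ger_pMl ?(dist_gt0 ZG zA.1)//.
by rewrite (radialE zA) -ler_pdivlMr// mul1r.
Qed.

(** The open polygon contains the segments from [0] to its points, and a connected
   set that contains [0] and avoids a line stays on the side of [0]; so it is the
   connected component. Shrinking towards [0] moves the closed polygon into it. *)
Lemma crofton_cellE : crofton_cell Z = [set x | forall z, Z z -> form z x <= z.1.1].
Proof.
pose O := [set x : R * R | forall z, Z z -> form z x < z.1.1].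
have cform z : continuous (form z).
  by move=> x; apply: cvgD; apply: cvgMr_tmp; [exact: cvg_fst|exact: cvg_snd].
have -> : crofton_cell Z = closure O.
  congr closure; apply/seteqP; split => x.
    move=> [C [C0 CZ cC] Cx] z Zz; have z0 := dist_gt0 ZG Zz.
    rewrite ltNge; apply/negP => zx.
    have /connected_intervalP/(_ 0 (form z x)) : connected (form z @` C).
      by apply: connected_continuous_connected => //; exact: continuous_subspaceT.
    move=> /(_ _ _ z.1.1)[]; last by move=> y Cy yE; have := CZ _ Cy; apply; exists z.
    - by exists 0 => //; rewrite /form/= !mul0r addr0.
    - by exists x.
    - by rewrite ltW.
  move=> Ox; exists [set s *: x | s in `[0, 1]] => //; last first.
    by exists 1; rewrite ?scale1r//= in_itv/= ler01 lexx.
  split.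
  - by exists 0; rewrite ?scale0r//= in_itv/= ler01 lexx.
  - move=> _ [s /= + <-] [z Zz]; rewrite in_itv/= /line => /andP[s0 s1] /= E.
    have z0 := dist_gt0 ZG Zz.
    suff : form z (s *: x) < z.1.1 by rewrite /form E ltxx.
    rewrite -[s *: x]addr0 -[X in _ + X](scale0r x) form_lin mul0r addr0.
    have := Ox _ Zz; have [f0|f0] := leP (form z x) 0; nra.
  - apply: connected_continuous_connected.
      by apply/connected_intervalP; exact: interval_is_interval.
    by apply: continuous_subspaceT => s; apply: cvgZr_tmp; exact: cvg_id.
apply/seteqP; split.
  have -> : [set x | forall z, Z z -> form z x <= z.1.1] =
      \bigcap_(z in Z) (form z @^-1` [set y | y <= z.1.1]) by [].
  have cl : closed (\bigcap_(z in Z) (form z @^-1` [set y | y <= z.1.1])).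
    apply: closed_bigI => z Zz; apply: preimage_closed; last exact: closed_le.
    by move=> x _; exact: cform.
  rewrite [X in _ `<=` X]((closure_id _).1 cl); apply: closure_subset => x Ox z Zz.
  by rewrite /= ltW// Ox.
move=> x xK B xB.
have /(_ _ xB) : s *: x @[s --> (1 : R)^'-] --> x.
  rewrite -[X in _ --> X]scale1r; apply: cvgZr_tmp.
  by apply: cvg_at_left_filter; exact: cvg_id.
move=> sB; near ((1 : R)^'-) => s.
have s1 : s < 1 by near: s; exact: nbhs_left_lt.
have s0 : 0 < s by near: s; exact: nbhs_left_gt.
exists (s *: x); split; last by near: s.
move=> z Zz; have z0 := dist_gt0 ZG Zz.
rewrite -[s *: x]addr0 -[X in _ + X](scale0r x) form_lin mul0r addr0.
have := xK _ Zz; nra.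
Unshelve. all: by end_near. Qed.

Lemma boundary_cell t : crofton_cell Z (boundary_point t).
Proof.
by rewrite crofton_cellE => z Zz; apply: polar_cell => //; rewrite (ltW (radial_gt0 t)) lexx.
Qed.

Lemma bounded_crofton_cell : bounded_set (crofton_cell Z).
Proof.
have [M MP] := radial_bounded; exists M; split; first exact: num_real.
move=> N MN x /=; rewrite crofton_cellE => xK; rewrite (le_trans _ (ltW MN))//.
have M0 : 0 <= M by rewrite (le_trans _ (MP 0))// ltW// radial_gt0.
have [->|] := eqVneq x 0; first by rewrite normr0.
case: x xK => x y xK /polar_coordinates[r [t [r0 _ xE yE]]].
have rM : r <= M.
  by rewrite (le_trans _ (MP t))// cell_polar// => z Zz; rewrite /polar -xE -yE xK.
rewrite prod_normE/= ge_max xE yE !normrM gtr0_norm//.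
by rewrite !(le_trans _ rM)// ler_piMr ?cos_max ?sin_max ?ltW.
Qed.

Lemma polar_inj r r' t t' : 0 < r -> 0 < r' -> 0 <= t < 2 * pi -> 0 <= t' < 2 * pi ->
  polar r t = polar r' t' -> r = r' /\ t = t'.
Proof.
move=> r0 r'0 tP t'P [c s].
have rr' : r = r'.
  apply/eqP; rewrite -(@eqrXn2 _ 2)// ?ltW// -[X in X == _]mulr1 -[X in _ == X]mulr1.
  rewrite -[X in _ * X == _](cos2Dsin2 t) -[X in _ == _ * X](cos2Dsin2 t').
  by rewrite !mulrDr -!exprMn c s.
split => //; subst r'; apply: cos_sin_inj => //.
  exact: (mulfI (lt0r_neq0 r0)).
exact: (mulfI (lt0r_neq0 r0)).
Qed.

(** Two lines cross transversally at the vertex, and a segment of the cell whose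
   interior meets a supporting line lies on that line. *)
Lemma extreme_corner t : corner Z t -> extreme_points (crofton_cell Z) (boundary_point t).
Proof.
move=> [z1 [z2 [z1A z2A z12]]]; split; first exact: boundary_cell.
move=> y w s; rewrite crofton_cellE => yK wK /andP[s0 s1] xE.
have on z : active Z t z -> form z y = z.1.1 /\ form z w = z.1.1.
  move=> zA; have /form_boundary := zA.1; move=> /(_ t)/iffRL/(_ zA).
  rewrite xE form_lin; have := yK _ zA.1; have := wK _ zA.1; nra.
have [y1 w1] := on _ z1A; have [y2 w2] := on _ z2A.
have det : cos z1.1.2 * sin z2.1.2 - cos z2.1.2 * sin z1.1.2 != 0.
  apply/eqP => det; apply: z12.
  have E := active_eq_gauge z1A z2A.
  apply: (gauge_inj ZG z1A.1 z2A.1 E (t := t + pi / 2)); last first.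
    by rewrite addrC addKr sin_pihalf oner_neq0.
  have c1 := active_cos_gt0 ZG z1A; have c2 := active_cos_gt0 ZG z2A.
  have p1 := dist_gt0 ZG z1A.1; have p2 := dist_gt0 ZG z2A.1.
  rewrite /gauge !opprD !addrA !cosBpihalf.
  have S : sin (z1.1.2 - t) * cos (z2.1.2 - t) = cos (z1.1.2 - t) * sin (z2.1.2 - t).
    apply/eqP; rewrite -subr_eq0 -sinB; apply/eqP.
    rewrite (_ : _ - _ - _ = z1.1.2 - z2.1.2); last by ring.
    by rewrite sinB; lra.
  have C : cos (z1.1.2 - t) = z1.1.1 * (cos (z2.1.2 - t) / z2.1.1).
    by rewrite -[X in _ * X]E mulrC divfK// gt_eqF.
  apply: (mulIf (lt0r_neq0 c2)); rewrite mulrAC S C; field.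
  by rewrite !gt_eqF.
have d1 : form z1 y = form z1 w by rewrite y1 w1.
have d2 : form z2 y = form z2 w by rewrite y2 w2.
case: y w {yK wK xE on y1 w1 y2 w2} d1 d2 => [ya yb] [wa wb]; rewrite /form/= => d1 d2.
congr pair; apply/eqP; rewrite -subr_eq0; apply/eqP; apply: (mulfI det); rewrite mulr0.
  transitivity (sin z2.1.2 * ((ya * cos z1.1.2 + yb * sin z1.1.2) -
    (wa * cos z1.1.2 + wb * sin z1.1.2)) - sin z1.1.2 *
    ((ya * cos z2.1.2 + yb * sin z2.1.2) - (wa * cos z2.1.2 + wb * sin z2.1.2))).
    by ring.
  by rewrite d1 d2 !subrr !mulr0 subrr.
transitivity (cos z1.1.2 * ((ya * cos z2.1.2 + yb * sin z2.1.2) -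
    (wa * cos z2.1.2 + wb * sin z2.1.2)) - cos z2.1.2 *
    ((ya * cos z1.1.2 + yb * sin z1.1.2) - (wa * cos z1.1.2 + wb * sin z1.1.2))).
  by ring.
by rewrite d1 d2 !subrr !mulr0 subrr.
Qed.

(** A point that is interior to its ray, or carried by one line only in all
   directions close to its own, is inside a segment of the cell. *)
Lemma corner_extreme x : extreme_points (crofton_cell Z) x ->
  exists t : R, [/\ 0 <= t < 2 * pi, corner Z t & x = boundary_point t].
Proof.
move=> [xK xE]; have K := xK; move: K; rewrite crofton_cellE => K.
have p0 := pi_gt0 R.
have polar0 r t : polar r t = 0 -> r = 0.
  move=> [c s]; have : r ^+ 2 = 0; last by move/eqP; rewrite sqrf_eq0 => /eqP.
  by rewrite -[LHS]mulr1 -(cos2Dsin2 t) mulrDr -!exprMn c s expr0n/= addr0.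
have Kpolar r t : 0 <= r <= radial t -> crofton_cell Z (polar r t).
  by move=> rt; rewrite crofton_cellE => z Zz; exact: polar_cell.
have [x0|] := eqVneq x 0.
  have r0 := radial_gt0 0; have rp := radial_gt0 pi.
  pose e := Num.min (radial 0) (radial pi).
  have e0 : 0 < e by rewrite lt_min r0.
  have [er ep] : e <= radial 0 /\ e <= radial pi by rewrite !ge_min !lexx orbT.
  have : polar e 0 = polar e pi.
    apply: (xE _ _ 2^-1).
    - by apply: Kpolar; rewrite er ltW.
    - by apply: Kpolar; rewrite ep ltW.
    - by rewrite invr_gt0 ltr0n invf_lt1 ?ltr1n.
    - transitivity ((0, 0) : R * R); first by rewrite x0.
      by rewrite scale_pairE /polar cos0 sin0 cospi sinpi/=; congr pair; field.
  by rewrite /polar cos0 cospi => -[]; lra.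
case: x xK xE K => x y xK xE K /polar_coordinates[r [t [r0 tP xr yr]]].
rewrite xr yr -/(polar r t) in xE K xK *.
have rt : r <= radial t by exact: cell_polar.
have R0 := radial_gt0 t.
have rtE : r = radial t.
  apply/eqP; rewrite eq_le rt leNgt; apply/negP => rlt.
  have : polar 0 t = polar (radial t) t.
    apply: (xE _ _ (r / radial t)).
    - by apply: Kpolar; rewrite lexx ltW.
    - by apply: Kpolar; rewrite lexx andbT ltW.
    - by rewrite divr_gt0//= ltr_pdivrMr// mul1r.
    - by rewrite scale_pairE /polar/=; congr pair; field; rewrite gt_eqF.
  by rewrite [X in X = _](_ : _ = 0) => [/esym/polar0|]; [lra|rewrite /polar !mul0r].
exists t; split => //; last by rewrite rtE.
apply: contrapT => nc.
have [z zA] := active_ex ZG t.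
have /nbhs_ballP[e/= e0 eP] := active_near ZG t.
(* The end points are on the boundary, in directions [t - h] and [t + h]. *)
pose h := Num.min (e / 2) (pi / 4).
have h0 : 0 < h by rewrite lt_min !divr_gt0.
have [he hp] : h <= e / 2 /\ h <= pi / 4 by rewrite !ge_min !lexx orbT.
have zN s : `|t - s| <= h -> active Z s z.
  move=> tsh; have [z' z'A] := active_ex ZG s.
  have /eP : ball t e s by rewrite /ball/=; lra.
  by move=> /(_ _ z'A) /(cornerN nc zA) ->.
have z1 : active Z (t - h) z by apply: zN; rewrite opprB addrC subrK gtr0_norm.
have z2 : active Z (t + h) z by apply: zN; rewrite opprD addNKr normrN gtr0_norm.
have g0 := active_gauge_gt0 ZG zA; have g1 := active_gauge_gt0 ZG z1.
have g2 := active_gauge_gt0 ZG z2.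
have ch : 0 < cos h by apply: cos_gt0_pihalf; lra.
have E : gauge z (t - h) + gauge z (t + h) = 2 * cos h * gauge z t.
  by rewrite !gaugeE cosB cosD sinB sinD; ring.
pose s := gauge z (t + h) / (2 * cos h * gauge z t).
have d0 : 0 < 2 * cos h * gauge z t.
  by apply: mulr_gt0 => //; exact: mulr_gt0.
have s1E : 1 - s = gauge z (t - h) / (2 * cos h * gauge z t).
  apply: (mulIf (lt0r_neq0 d0)); rewrite mulrBl mul1r /s !divfK ?gt_eqF// -E.
  by rewrite addrK.
have : boundary_point (t - h) = boundary_point (t + h).
  apply: (xE _ _ s); [exact: boundary_cell|exact: boundary_cell| |].
    by rewrite divr_gt0//= -subr_gt0 s1E divr_gt0.
  rewrite s1E /s /boundary_point rtE !(radialE zA) (radialE z1) (radialE z2).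
  rewrite scale_pairE /polar/=; congr pair.
    by rewrite cosB cosD; field; rewrite !gt_eqF.
  by rewrite sinB sinD; field; rewrite !gt_eqF.
rewrite /boundary_point (radialE z1) (radialE z2) => -[c_ s_].
have : (gauge z (t - h))^-1 * (gauge z (t + h))^-1 * sin (t + h - (t - h)) = 0.
  rewrite sinB; transitivity (((gauge z (t - h))^-1 * cos (t - h)) *
      ((gauge z (t + h))^-1 * sin (t + h)) - ((gauge z (t - h))^-1 * sin (t - h)) *
      ((gauge z (t + h))^-1 * cos (t + h))); first by ring.
  by rewrite c_ s_; ring.
apply/eqP; rewrite gt_eqF// !mulr_gt0 ?invr_gt0// sin_gt0_pi//.
by rewrite (_ : t + h - (t - h) = 2 * h); [lra|ring].
Qed.

Definition corner_list n (ang : 'I_n -> R) : Prop :=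
  [/\ forall i, 0 <= ang i < 2 * pi, forall i j : 'I_n, (i < j)%N -> ang i < ang j &
      forall t, 0 <= t < 2 * pi -> corner Z t <-> exists i, ang i = t].

(** The angle of the next corner, lifted so that it is larger than [ang i]. *)
Definition next_angle n (ang : 'I_n -> R) (i : 'I_n) : R :=
  if ang i < ang (ordS i) then ang (ordS i) else ang (ordS i) + 2 * pi.

Lemma next_angleE n (ang : 'I_n -> R) i :
  cos (next_angle ang i) = cos (ang (ordS i)) /\
  sin (next_angle ang i) = sin (ang (ordS i)).
Proof.
by rewrite /next_angle; case: ifP => // _; rewrite addrC cos_2piD sin_2piD.
Qed.

Lemma corner_list_lt n (ang : 'I_n -> R) i j : corner_list ang ->
  ang i < ang j -> (i < j)%N.
Proof.
move=> [_ mono _]; apply: contraTT; rewrite -leqNgt -leNgt leq_eqVlt.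
by move=> /orP[/eqP/val_inj ->//|/mono/ltW].
Qed.

Lemma next_angle_gt n (ang : 'I_n -> R) i : corner_list ang -> ang i < next_angle ang i.
Proof.
move=> [ang2 _ _]; rewrite /next_angle; case: ifP => // _.
by have := ang2 i; have := ang2 (ordS i); lra.
Qed.

Lemma no_corner_next n (ang : 'I_n -> R) i s : corner_list ang ->
  ang i < s < next_angle ang i -> ~ corner Z s.
Proof.
move=> angP; have [ang2 mono cP] := angP.
have := ang2 i; have := ang2 (ordS i); rewrite /next_angle => /andP[q1 q2] /andP[i1 i2].
have [in_|] := ltnP i.+1 n.
  have oi : ordS i = i.+1 :> nat by rewrite /= modn_small.
  have lt_ : ang i < ang (ordS i) by apply: mono; rewrite oi.
  rewrite lt_ => /andP[is_ so] /cP[|j js]; first lra.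
  move: is_ so; rewrite -js => /(corner_list_lt angP) ij /(corner_list_lt angP).
  by rewrite oi ltnS leqNgt ij.
move=> ni; have oi : ordS i = 0%N :> nat.
  by rewrite /= (_ : i.+1 = n) ?modnn//; apply/eqP; rewrite eqn_leq ltn_ord.
have le_ : ang (ordS i) <= ang i.
  have := leq0n i; rewrite -oi leq_eqVlt => /orP[/eqP/val_inj ->//|/mono/ltW//].
rewrite [X in if X then _ else _]ltNge le_/= => /andP[is_ so] sc.
have [s2|s2] := ltP s (2 * pi).
  have [|j js] := (cP s _).1 sc; first lra.
  move: is_; rewrite -js => /(corner_list_lt angP) ij.
  by have := leq_trans (ltn_ord j) ni; rewrite ltnNge ij.
have sc' : corner Z (s - 2 * pi).
  by apply: eq_corner sc; rewrite -[s in LHS](subrKC (2 * pi)) ?cos_2piD ?sin_2piD.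
have [|j js] := (cP (s - 2 * pi) _).1 sc'; first lra.
have : ang j < ang (ordS i) by rewrite js; lra.
by move=> /(corner_list_lt angP); rewrite oi.
Qed.

(** Some line is active throughout the arc, so the arc is shorter than [pi], and
   a line that ties with it at both ends is the same line. *)
Lemma active_next n (ang : 'I_n -> R) i z : corner_list ang ->
  active Z (ang i) z -> active Z (ang (ordS i)) z ->
  forall s, ang i <= s <= next_angle ang i -> active Z s z.
Proof.
move=> angP zi zo; have lt_ := next_angle_gt i angP.
have [z0 Zz0 z0A] := active_between ZG lt_ (fun s => no_corner_next angP (s := s)).
have z0i : active Z (ang i) z0 by apply: z0A; rewrite lexx ltW.
have lt_pi := active_short z0i z0A.
have [cE sE] := next_angleE ang i.
have zn : active Z (next_angle ang i) z by apply: eq_active zo; rewrite ?cE ?sE.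
suff -> : z = z0 by [].
apply: (gauge_inj_near ZG zi.1 Zz0 (s := ang i) (t := next_angle ang i)).
- exact: active_eq_gauge zi z0i.
- by apply: active_eq_gauge zn _; apply: z0A; rewrite lexx ltW.
- by rewrite lt_.
Qed.

Lemma ex_active_next n (ang : 'I_n -> R) i : corner_list ang ->
  exists z, active Z (ang i) z /\ active Z (ang (ordS i)) z.
Proof.
move=> angP; have lt_ := next_angle_gt i angP.
have [z Zz zA] := active_between ZG lt_ (fun s => no_corner_next angP (s := s)).
exists z; split; first by apply: zA; rewrite lexx ltW.
have [cE sE] := next_angleE ang i.
by apply: (eq_active cE sE); apply: zA; rewrite lexx ltW.
Qed.

Lemma labels_ex : exists L, labels Z L.
Proof.
have /finite_seqP[l lE] := finite_corners.
pose c := sort <=%O (undup l).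
have cl t : t \in c <-> 0 <= t < 2 * pi /\ corner Z t.
  rewrite mem_sort mem_undup; split => [tl|tP].
    by have : [set` l] t by []; rewrite -lE.
  by have : [set t : R | 0 <= t < 2 * pi /\ corner Z t] t by []; rewrite lE.
have cs : sorted <%O c by rewrite sort_lt_sorted undup_uniq.
pose ang (i : 'I_(size c)) := nth 0 c i.
have angc i : ang i \in c by exact: mem_nth.
have angP : corner_list ang.
  split => [i|i j ij|t tP]; first exact: ((cl _).1 (angc i)).1.
    by rewrite /ang (sorted_ltn_nth lt_trans)// inE.
  split => [tc|[i <-]]; last exact: ((cl _).1 (angc i)).2.
  have tl : t \in c by apply/cl.
  have ti : (index t c < size c)%N by rewrite index_mem.
  by exists (Ordinal ti); rewrite /ang nth_index.
have /choice[m mP] := fun i => ex_active_next i angP.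
exists (Labelling (boundary_point \o ang) ang m); split => /=.
- exact: bounded_crofton_cell.
- apply/seteqP; split => [_ [i _ <-]|x].
    by apply: extreme_corner; exact: ((cl _).1 (angc i)).2.
  have [_ _ angC] := angP.
  move=> /corner_extreme[t [tP /(angC _ tP)[i it] ->]].
  by exists i => //=; rewrite it.
- move=> i; split; first by case: angP.
  by exists (radial (ang i)); rewrite ?radial_gt0.
- by case: angP.
- move=> i; have [mi mo] := mP i; split; first exact: mi.1.
  move=> _ [s _ <-]; rewrite /line/=.
  have := form_lin (m i) (boundary_point (ang i)) (boundary_point (ang (ordS i))) (1 - s) s.
  have /form_boundary := mi.1 => /(_ (ang i))/iffRL/(_ mi) ->.
  have /form_boundary := mi.1 => /(_ (ang (ordS i)))/iffRL/(_ mo) ->.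
  by rewrite /form/= => ->; ring.
Qed.

Section labelling.
Variable L : @labelling R.
Hypothesis LP : labels Z L.

Lemma labels_vertex i : corner Z (@angle _ L i) /\
  vertex i = boundary_point (@angle _ L i).
Proof.
have [_ Lr La _ _] := LP; have [ai [r r0 vE]] := La i.
have : extreme_points (crofton_cell Z) (vertex i) by rewrite -Lr; exists i.
move=> /corner_extreme[t [tP tc vE']].
have [_ at_] : r = radial t /\ angle i = t.
  by apply: polar_inj => //; [exact: radial_gt0|rewrite /polar -vE vE'].
by rewrite at_.
Qed.

Lemma labels_corner_list : corner_list (@angle _ L).
Proof.
have [_ Lr La Lm _] := LP; split => //; first by move=> i; exact: (La i).1.
move=> t tP; split => [/extreme_corner|[i <-]]; last exact: (labels_vertex i).1.
rewrite -Lr => -[i _ iE]; exists i.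
have [_] := labels_vertex i; rewrite iE => /polar_inj[] //; first exact: radial_gt0.
- exact: radial_gt0.
- exact: (La i).1.
Qed.

(** The half-open edge contains its midpoint, so the line contains both vertices. *)
Lemma edge_mark_active i : active Z (angle i) (@edge_mark _ L i) /\
  active Z (angle (ordS i)) (@edge_mark _ L i).
Proof.
have [_ _ _ _ /(_ i)[Zi Li]] := LP.
have [_ v0] := labels_vertex i; have [_ v1] := labels_vertex (ordS i).
have f0 : form (edge_mark i) (vertex i) = (edge_mark i).1.1.
  apply: Li; exists 0; first by rewrite /= in_itv/= lexx ltr01.
  by rewrite subr0 scale1r scale0r addr0.
have f1 : form (edge_mark i) ((1 - 2^-1) *: vertex i + 2^-1 *: vertex (ordS i)) =
    (edge_mark i).1.1.
  apply: Li; exists 2^-1 => //.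
  by rewrite /= in_itv/= invr_ge0 ler0n invf_lt1 ?ltr1n.
split; apply/form_boundary => //; first by rewrite -v0.
rewrite -v1; move: f1; rewrite form_lin f0.
set a := form _ _; set b := (edge_mark i).1.1 => f1.
have : 2^-1 * (a - b) = 0 by rewrite mulrBr -[in RHS](subrr b) -{2}f1; field.
by move=> /eqP; rewrite mulf_eq0 invr_eq0 pnatr_eq0/= subr_eq0 => /eqP.
Qed.

Lemma in_arc_active i t : 0 <= t < 2 * pi -> @in_arc _ L i t -> active Z t (edge_mark i).
Proof.
move=> tP; have [m1 m2] := edge_mark_active i.
have := active_next labels_corner_list m1 m2; rewrite /in_arc /next_angle.
have [_ _ La _ _] := LP; have := (La i).1; have := (La (ordS i)).1.
move=> a1 a2; case: ifP => [_ A /andP[t1 t2]|/negbT io A /orP[it|ti]].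
- by apply: A; rewrite t1 ltW.
- by apply: A; lra.
- have : active Z (t + 2 * pi) (edge_mark i) by apply: A; lra.
  by apply: eq_active; rewrite addrC ?cos_2piD ?sin_2piD.
Qed.

Lemma ex_in_arc t : 0 <= t < 2 * pi -> exists i, @in_arc _ L i t.
Proof.
move=> tP; have angP := labels_corner_list; have [La Lm Lc] := angP.
have [t0 /Lc/[apply][[i0 _]]] := ex_corner.
have n0 : (0 < nb_vertices L)%N by rewrite (leq_trans _ (ltn_ord i0)).
have lastP : exists l : 'I_(nb_vertices L), l.+1 = nb_vertices L :> nat /\
    ordS l = 0%N :> nat.
  case: (nb_vertices L) n0 => // n _; exists ord_max => /=; split => //.
  by rewrite modnn.
have [l [lE l0]] := lastP.
have wrap : (angle l <= t) || (t < angle (ordS l)) -> exists i, @in_arc _ L i t.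
  move=> lt_; exists l; rewrite /in_arc ifF//; apply/negbTE; rewrite -leNgt.
  by have := leq0n l; rewrite -l0 leq_eqVlt => /orP[/eqP/val_inj ->//|/Lm/ltW].
have [[j jt]|nj] := pselect (exists j : 'I_(nb_vertices L), angle j <= t); last first.
  by apply: wrap; rewrite orbC ltNge; case: leP => // h; case: nj; exists (ordS l).
pose P (k : nat) := [exists j : 'I_(nb_vertices L), (j == k :> nat) && (angle j <= t)].
have exP : exists k, P k by exists j; apply/existsP; exists j; rewrite eqxx.
have ubP k : P k -> (k <= nb_vertices L)%N.
  by move=> /existsP[i /andP[/eqP <- _]]; exact: ltnW.
case: (ex_maxnP exP ubP) => k /existsP[i /andP[/eqP ik it]] kmax.
have [iN|iN] := ltnP i.+1 (nb_vertices L); last first.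
  apply: wrap; rewrite (_ : l = i) ?it//; apply/val_inj/eqP.
  by rewrite /= -eqSS lE eqn_leq iN ltn_ord.
have oi : ordS i = i.+1 :> nat by rewrite /= modn_small.
exists i; rewrite /in_arc ifT ?Lm ?oi// it/= ltNge; apply/negP => ot.
have : P i.+1 by apply/existsP; exists (ordS i); rewrite oi eqxx.
by move=> /kmax; rewrite ik ltnn.
Qed.

End labelling.

Lemma labelling_ofP : labels Z (labelling_of Z).
Proof.
rewrite /labelling_of; case: pselect => [e|]; last by have := labels_ex.
by case: cid.
Qed.

Lemma mark_at_active t : 0 <= t < 2 * pi -> active Z t (mark_at Z t).
Proof.
move=> tP; rewrite /mark_at; case: pickP => [i /(in_arc_active labelling_ofP tP)//|no].
by have [i] := ex_in_arc labelling_ofP tP; rewrite no.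
Qed.

Lemma mark_at_right t : 0 <= t < 2 * pi ->
  \forall s \near t^'+, mark_at Z s = mark_at Z t.
Proof.
move=> tP; have [z zA zE] := right_isolation t.
have [i [iP mi]] : exists i, @in_arc _ (labelling_of Z) i t /\ mark_at Z t = edge_mark i.
  rewrite /mark_at; case: pickP => [i iP|no]; first by exists i.
  by have [i] := ex_in_arc labelling_ofP tP; rewrite no.
have [/andP[t0 t2]] := tP.
have iR : \forall s \near t^'+, @in_arc _ (labelling_of Z) i s.
  move: iP; rewrite /in_arc; case: ifP => _.
    move=> /andP[it to]; near=> s; apply/andP; split.
      by rewrite (le_trans it)//; near: s; exact: nbhs_right_ge.
    by near: s; exact: nbhs_right_lt.
  move=> /orP[it|to]; near=> s; apply/orP; [left|right].
    by rewrite (le_trans it)//; near: s; exact: nbhs_right_ge.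
  by near: s; exact: nbhs_right_lt.
near=> s.
have sP : 0 <= s < 2 * pi.
  apply/andP; split; first by rewrite (le_trans t0)//; near: s; exact: nbhs_right_ge.
  by near: s; exact: nbhs_right_lt.
have zs : forall z', active Z s z' -> z' = z by near: s.
have is_ : @in_arc _ (labelling_of Z) i s by near: s.
by rewrite mi (zs _ (mark_at_active sP)) (zs _ (in_arc_active labelling_ofP sP is_)).
Unshelve. all: by end_near. Qed.

(** The left limit of the mark at [t] may differ from its value at [t], but it is
   active at [t] as well. *)
Lemma mark_at_left t : 0 < t <= 2 * pi -> exists2 z, active Z t z &
  \forall s \near t^'-, mark_at Z s = z.
Proof.
move=> /andP[t0 t2]; have [z zA zE] := left_isolation t; exists z => //.
near=> s.
have sP : 0 <= s < 2 * pi.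
  apply/andP; split; first by near: s; exact: nbhs_left_ge.
  by rewrite (lt_le_trans _ t2)//; near: s; exact: nbhs_left_lt.
have zs : forall z', active Z s z' -> z' = z by near: s.
exact: zs (mark_at_active sP).
Unshelve. all: by end_near. Qed.

(** A tie at [t] is resolved by the directions that follow, because the mark is
   right-continuous and the ties are isolated. *)
Lemma active_right t : 0 <= t < 2 * pi ->
  \forall s \near t^'+, forall z, active Z s z <-> z = mark_at Z t.
Proof.
move=> tP; have [z zA zE] := right_isolation t; have mE := mark_at_right tP.
case/andP: tP => t0 t2; near=> s.
have sP : 0 <= s < 2 * pi.
  apply/andP; split; first by rewrite (le_trans t0)//; near: s; exact: nbhs_right_ge.
  by near: s; exact: nbhs_right_lt.
have zs : forall z', active Z s z' -> z' = z by near: s.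
have ms : mark_at Z s = mark_at Z t by near: s.
have mA := mark_at_active sP; rewrite ms in mA.
by move=> z'; split => [/zs ->|->//]; rewrite (zs _ mA).
Unshelve. all: by end_near. Qed.

End corners.
(** * Paths driven by the mark and expansion of the defect *)

Section mark_paths.
Context {R : realType}.
Implicit Types (z : R * R * R) (s t lam : R).
Variables (Rs : R) (Z : set (R * R * R)).
Hypothesis ZG : generic Rs Z.

Lemma skorohod_ofE (a b : R) (x0 : skorohod a b) (f : R -> R) t :
  cadlag a b f -> t \in `[a, b] -> skorohod_of x0 f t = f t.
Proof.
by move=> fD tab; rewrite /skorohod_of; case: pselect => // fD'; rewrite /= tab.
Qed.

(** Along an arc the path is the function of the mark of that arc, which is
   still active, hence of positive cosine, at both ends of the arc. *)
Lemma cadlag_mark_path (F : R * R * R -> R -> R) :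
  (forall t z, active Z t z -> {for t, continuous (F z)}) ->
  cadlag 0 (2 * pi) (periodize (fun t => F (mark_at Z t) t)).
Proof.
move=> Fc; split => t.
  move=> tP; have /andP[t0 t2] := tP.
  rewrite {2}/periodize lt_eqF//.
  have Fm : F (mark_at Z t) s @[s --> t^'+] --> F (mark_at Z t) t.
    by apply: cvg_at_right_filter; apply: Fc; exact: (mark_at_active ZG tP).
  apply: cvg_trans Fm; apply: near_eq_cvg; have mE := mark_at_right ZG tP.
  near=> s; rewrite /periodize lt_eqF; last by near: s; exact: nbhs_right_lt.
  by have -> : mark_at Z s = mark_at Z t by near: s.
move=> tP; have [z zA zE] := mark_at_left ZG tP; have /andP[t0 t2] := tP.
apply/cvg_ex; exists (F z t).
have Fm : F z s @[s --> t^'-] --> F z t.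
  by apply: cvg_at_left_filter; apply: Fc.
apply: cvg_trans Fm; apply: near_eq_cvg.
near=> s; rewrite /periodize lt_eqF; last first.
  by rewrite (lt_le_trans _ t2)//; near: s; exact: nbhs_left_lt.
by have -> : mark_at Z s = z by near: s.
Unshelve. all: by end_near. Qed.

(** The rescaled defect, the limit and the bound on [lam] as functions of the mark,
   to be composed with the mark read at [t]. *)
Definition defect_mark lam z t : R :=
  let u := z.1.1 in
  let phi := z.1.2 - t in
  let r := z.2 in
  lam ^+ 2 * (lam ^+ 2 * r * cos phi * Num.sqrt (1 + 2 * u / (lam ^+ 2 * r))
  - lam ^+ 2 * r *
      Num.sqrt (1 - sin phi ^+ 2 * (1 + 2 * u / (lam ^+ 2 * r)))
  - u / cos phi).

Definition limit_mark z t : R :=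
  let u := z.1.1 in
  let phi := z.1.2 - t in
  let r := z.2 in
  - (u ^+ 2 / (2 * r)) * (cos (2 * phi) / cos phi ^+ 3).

Definition threshold_mark z t : R :=
  Num.sqrt (2 * z.1.1 * tan (z.1.2 - t) ^+ 2 / z.2).

Lemma cvg_phase (f : R -> R) z t : {for z.1.2 - t, continuous f} ->
  f (z.1.2 - s) @[s --> t] --> f (z.1.2 - t).
Proof.
move=> fc; apply: (@continuous_comp _ _ _ (fun s => z.1.2 - s) f) => //.
by apply: cvgB; [exact: cvg_cst|exact: cvg_id].
Qed.

Lemma continuous_defect_mark lam z t : 0 < cos (z.1.2 - t) ->
  {for t, continuous (defect_mark lam z)}.
Proof.
move=> c0; have cc : cos (z.1.2 - s) @[s --> t] --> cos (z.1.2 - t).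
  by apply: cvg_phase; exact: continuous_cos.
have cs : sin (z.1.2 - s) @[s --> t] --> sin (z.1.2 - t).
  by apply: cvg_phase; exact: continuous_sin.
apply: cvgM; first exact: cvg_cst.
apply: cvgB; last first.
  by apply: cvgM; [exact: cvg_cst|apply: cvgV; rewrite ?gt_eqF].
apply: cvgB.
  by apply: cvgM; [apply: cvgM => //; exact: cvg_cst|exact: cvg_cst].
apply: cvgM; first exact: cvg_cst.
apply: (@continuous_comp _ _ _ (fun s => 1 - sin (z.1.2 - s) ^+ 2 * _) (@Num.sqrt R)).
  apply: cvgB; first exact: cvg_cst.
  by apply: cvgM; [exact: cvgM|exact: cvg_cst].
exact: sqrt_continuous.
Qed.

Lemma continuous_limit_mark z t : 0 < cos (z.1.2 - t) ->
  {for t, continuous (limit_mark z)}.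
Proof.
move=> c0; have cc : cos (z.1.2 - s) @[s --> t] --> cos (z.1.2 - t).
  by apply: cvg_phase; exact: continuous_cos.
apply: cvgM; first exact: cvg_cst.
apply: cvgM.
  have c2 : continuous (fun x : R => cos (2 * x)).
    move=> x; exact: (continuous_comp (@mulrl_continuous _ 2 x) (@continuous_cos _ _)).
  exact: (@cvg_phase (fun x => cos (2 * x)) z t (c2 _)).
apply: cvgV; first by rewrite expf_neq0// gt_eqF.
by rewrite /GRing.exp/=; apply: cvgM => //; exact: cvgM.
Qed.

Lemma continuous_threshold_mark z t : 0 < cos (z.1.2 - t) ->
  {for t, continuous (threshold_mark z)}.
Proof.
move=> c0.
have ct : tan (z.1.2 - s) @[s --> t] --> tan (z.1.2 - t).
  by apply: cvg_phase; apply: continuous_tan; rewrite gt_eqF.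
apply: (@continuous_comp _ _ _ (fun s => 2 * z.1.1 * tan (z.1.2 - s) ^+ 2 / z.2) (@Num.sqrt R)).
  by apply: cvgM; [apply: cvgM; [exact: cvg_cst|exact: cvgM]|exact: cvg_cst].
exact: sqrt_continuous.
Qed.

(** With [s = sqrt (1 + y)], the remainder is [(s - 1) ^ 3 * (s + 3) / 8] and
   [y = (s - 1) * (s + 1)]. *)
Lemma sqrt_taylor2 (y : R) : -1 <= y ->
  `|Num.sqrt (1 + y) - (1 + y / 2 - y ^+ 2 / 8)| <= `|y| ^+ 3.
Proof.
move=> y1; pose s : R := Num.sqrt (1 + y); rewrite -/s.
have s0 : 0 <= s by exact: sqrtr_ge0.
have s2 : s ^+ 2 = 1 + y by rewrite sqr_sqrtr//; lra.
have -> : y = (s - 1) * (s + 1) by rewrite -subr_sqr s2 expr1n addrAC subrr add0r.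
have -> : s - (1 + (s - 1) * (s + 1) / 2 - ((s - 1) * (s + 1)) ^+ 2 / 8) =
    (s - 1) ^+ 3 * ((s + 3) / 8) by field.
rewrite [X in _ <= X ^+ 3]normrM exprMn [leLHS]normrM normrX ler_wpM2l ?exprn_ge0//.
rewrite !ger0_norm; [|by rewrite addr_ge0|by rewrite divr_ge0// addr_ge0].
rewrite ler_pdivrMr// (_ : (s + 1) ^+ 3 = s ^+ 3 + 3 * s ^+ 2 + 3 * s + 1); last by ring.
have : 0 <= s ^+ 3 by exact: exprn_ge0.
have : 0 <= s ^+ 2 by exact: exprn_ge0.
lra.
Qed.

(** The expansion of both square roots to second order in
   [x = 2 u / (lam ^ 2 r)]: the orders 0 and 1 cancel [u / cos phi], the order 2
   gives the limit, and the remainder is of order [lam ^ -2]. *)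
Lemma defect_mark_error (K m lam t : R) z : 0 < m -> 0 < Rs -> 0 < lam ->
  0 < z.1.1 <= K -> m <= cos (z.1.2 - t) -> Rs < z.2 ->
  2 * K / (m ^+ 2 * Rs) <= lam ^+ 2 ->
  `|limit_mark z t - defect_mark lam z t| <=
    8 * K ^+ 3 * (1 + m ^- 2 ^+ 3) / Rs ^+ 2 / lam ^+ 2.
Proof.
move=> m0 Rs0 lam0 /andP[u0 uK] mc Rr lamK.
rewrite /limit_mark /defect_mark; set u := z.1.1 in u0 uK *; set r := z.2 in Rr *.
set phi := z.1.2 - t in mc *; set c := cos phi in mc *; set L := lam ^+ 2 in lamK *.
have c0 : 0 < c by exact: lt_le_trans mc.
have c1 : c <= 1 by exact: cos_le1.
have r0 : 0 < r by exact: lt_trans Rr.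
have L0 : 0 < L by exact: exprn_gt0.
pose T := sin phi ^+ 2 / c ^+ 2.
have c20 : 0 < c ^+ 2 by exact: exprn_gt0.
have T0 : 0 <= T by rewrite divr_ge0 ?sqr_ge0// ltW.
have T1 : 1 + T = c ^- 2.
  by rewrite /T -[X in X + _](mulfV (lt0r_neq0 c20)) -mulrDl cos2Dsin2 mul1r.
have sT : sin phi ^+ 2 = T * c ^+ 2 by rewrite divfK ?gt_eqF.
have Tm : T <= m ^- 2.
  apply: (@le_trans _ _ (c ^- 2)); first by rewrite -T1 lerDr.
  by rewrite lef_pV2 ?posrE ?exprn_gt0// lerXn2r// nnegrE ltW.
set x := 2 * u / (L * r).
have x0 : 0 < x by rewrite divr_gt0// mulr_gt0.
have Tx1 : T * x <= 1.
  rewrite /x mulrA ler_pdivrMr ?mulr_gt0// mul1r.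
  apply: (@le_trans _ _ (m ^- 2 * (2 * K))).
    by rewrite ler_pM// ?mulr_ge0 ?ler_pM2l// ltW.
  apply: (@le_trans _ _ (L * Rs)); last by rewrite ler_pM2l// ltW.
  by move: lamK; rewrite invfM mulrA ler_pdivrMr// mulrC.
have -> : 1 - sin phi ^+ 2 * (1 + x) = c ^+ 2 * (1 + - (T * x)).
  rewrite sT; transitivity (c ^+ 2 + T * c ^+ 2 - T * c ^+ 2 * (1 + x)); last by ring.
  by rewrite -sT cos2Dsin2.
rewrite sqrtrM ?sqr_ge0// sqrtr_sqr (gtr0_norm c0).
have E1 := sqrt_taylor2 (y := x) ltac:(by lra).
have E2 := sqrt_taylor2 (y := - (T * x)) ltac:(by lra).
set s := Num.sqrt (1 + x) in E1 *; set w := Num.sqrt (1 + - (T * x)) in E2 *.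
set f1 := s - _ in E1; set f2 := w - _ in E2.
have c2 : cos (2 * phi) = c ^+ 2 - T * c ^+ 2.
  by rewrite -sT mulr_natl cos_mulr2n -/c sin2cos2 -/c; ring.
have -> : - (u ^+ 2 / (2 * r)) * (cos (2 * phi) / c ^+ 3) -
    L * (L * r * c * s - L * r * (c * w) - u / c) = - (L * (L * r) * c * (f1 - f2)).
  have uc : u / c = u * c * (1 + T) by rewrite T1; field; rewrite gt_eqF.
  have c3 : cos (2 * phi) / c ^+ 3 = c * (1 - T) * (1 + T).
    by rewrite c2 T1; field; rewrite gt_eqF.
  rewrite c3 uc /f1 /f2 /x; field.
  by rewrite !gt_eqF.
have fb : `|f1 - f2| <= x ^+ 3 * (1 + m ^- 2 ^+ 3).
  rewrite (le_trans (ler_normB _ _))// mulrDr mulr1 lerD//.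
    by move: E1; rewrite (gtr0_norm x0).
  rewrite (le_trans E2)// normrN normrM !ger0_norm ?(ltW x0)// exprMn mulrC.
  by rewrite ler_pM2l ?exprn_gt0// lerXn2r ?nnegrE// invr_ge0 sqr_ge0.
rewrite normrN normrM gtr0_norm; last by rewrite !mulr_gt0.
apply: (@le_trans _ _ (L * (L * r) * 1 * (x ^+ 3 * (1 + m ^- 2 ^+ 3)))).
  have Lr0 : 0 < L * (L * r) by rewrite mulr_gt0// mulr_gt0.
  apply: ler_pM => //; first exact: (mulr_ge0 (ltW Lr0) (ltW c0)).
  by rewrite ler_pM2l.
have -> : L * (L * r) * 1 * (x ^+ 3 * (1 + m ^- 2 ^+ 3)) =
    8 * u ^+ 3 * (1 + m ^- 2 ^+ 3) / r ^+ 2 / L.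
  by rewrite /x; field; rewrite !gt_eqF.
have p0 : 0 <= 1 + m ^- 2 ^+ 3 by rewrite addr_ge0// exprn_ge0// invr_ge0 sqr_ge0.
rewrite ler_pM2r ?invr_gt0// ler_pM//.
- by rewrite mulr_ge0// mulr_ge0// exprn_ge0// ltW.
- by rewrite invr_ge0 sqr_ge0.
- by rewrite ler_wpM2r// ler_pM2l// lerXn2r// nnegrE ltW// (lt_le_trans u0).
- by rewrite lef_pV2 ?posrE ?exprn_gt0// lerXn2r ?nnegrE ?ltW.
Qed.

(** Only finitely many lines can be active, so their distances to the origin are
   bounded above and below; and the cosine of the angle under which an active
   line is seen is bounded below in proportion to that distance. *)
Lemma active_bounds : exists K m : R, 0 < m /\ forall t z, active Z t z ->
  0 < z.1.1 <= K /\ m <= cos (z.1.2 - t).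
Proof.
have [l [l1 l2 l3]] := finite_competitors ZG.
have [c c0 cP] := gauge_lower_bound ZG.
have [z0 z0A] := active_ex ZG 0; have z0l := l2 _ _ z0A.
have [zmax zmaxl maxP] := argmax_seq (fun z => z.1.1) z0l.
have [zmin zminl minP] := argmax_seq (fun z => - z.1.1) z0l.
have d0 := dist_gt0 ZG (l1 _ zminl).
exists zmax.1.1, (c * zmin.1.1); split; first exact: mulr_gt0.
move=> t z zA; have zl := l2 _ _ zA; split.
  by rewrite (dist_gt0 ZG zA.1)/= maxP.
have [z' Zz' cz'] := cP t; have := le_trans cz' (zA.2 _ Zz').
rewrite /gauge ler_pdivlMr ?(dist_gt0 ZG zA.1)//; apply: le_trans.
by rewrite ler_pM2l// -lerN2 minP.
Qed.

(** The convergence is uniform, so the identity is a suitable time change. *)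
Lemma skorohod_cvg (x0 : skorohod 0 (2 * pi)) : 0 < Rs -> forall e : R, 0 < e ->
  exists A, forall lam, A < lam ->
    sko_ball (limit_process Z) e (scaled_defect x0 lam Z).
Proof.
move=> Rs0 e e0; have [K [m [m0 KmP]]] := active_bounds.
have rP t z : active Z t z -> Rs < z.2.
  by move=> [Zz _]; have [/(_ _ Zz)[]] := ZG.
have K0 : 0 < K.
  by have [z zA] := active_ex ZG 0; have [/andP[+ +] _] := KmP _ _ zA; exact: lt_le_trans.
pose B1 := 2 * K / (m ^+ 2 * Rs).
pose B2 := 8 * K ^+ 3 * (1 + m ^- 2 ^+ 3) / Rs ^+ 2.
have B20 : 0 <= B2.
  rewrite divr_ge0 ?sqr_ge0// mulr_ge0//; first by rewrite mulr_ge0// exprn_ge0// ltW.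
  by rewrite addr_ge0// exprn_ge0// invr_ge0 sqr_ge0.
have B10 : 0 < B1 by rewrite divr_gt0 ?mulr_gt0// exprn_gt0.
exists (Num.max 1 (Num.max B1 (B2 / (e / 2)))) => lam.
rewrite !gt_max => /and3P[lam1 lamB1 lamB2].
have lam0 : 0 < lam by lra.
have lam2 : lam <= lam ^+ 2 by rewrite expr2 ler_peMl// ltW.
have lam20 : 0 < lam ^+ 2 by exact: exprn_gt0.
have lamK : B1 <= lam ^+ 2 by rewrite (le_trans (ltW lamB1)).
have dd : defect_defined Z lam.
  split => //; first exact: (labels_ex ZG).
  move=> t tP; have zA := mark_at_active ZG tP; have [/andP[u0 uK] mc] := KmP _ _ zA.
  have := rP _ _ zA; rewrite /Upsilon /Theta /Radius => Rr.
  rewrite -[leRHS](ger0_norm (ltW lam0)) -sqrtr_sqr ler_wsqrtr// (le_trans _ lamK)//.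
  have c0 : 0 < cos ((mark_at Z t).1.2 - t) by exact: lt_le_trans mc.
  have Tm : tan ((mark_at Z t).1.2 - t) ^+ 2 <= m ^- 2.
    apply: (@le_trans _ _ (cos ((mark_at Z t).1.2 - t) ^- 2)).
      by rewrite cos2_tan2 ?gt_eqF// lerDr.
    by rewrite lef_pV2 ?posrE ?exprn_gt0// lerXn2r// nnegrE ltW.
  rewrite (_ : B1 = 2 * K * m ^- 2 * Rs^-1); last by rewrite /B1 invfM mulrA.
  rewrite ler_pM//.
  - by rewrite mulr_ge0 ?sqr_ge0// mulr_ge0// ltW.
  - by rewrite invr_ge0 (le_trans _ (ltW Rr))// ltW.
  - by rewrite ler_pM// ?sqr_ge0 ?ler_pM2l// mulr_ge0// ltW.
  - by rewrite lef_pV2 ?posrE ?(ltW Rr)// (lt_trans Rs0).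
have cD : cadlag 0 (2 * pi) (periodize (fun t => lam ^+ 2 * defect Z lam t)).
  apply: (@cadlag_mark_path (defect_mark lam)) => t z zA.
  by apply: continuous_defect_mark; exact: (active_cos_gt0 ZG zA).
have cL : cadlag 0 (2 * pi) (periodize (fun t => limit_mark (mark_at Z t) t)).
  apply: (@cadlag_mark_path limit_mark) => t z zA.
  by apply: continuous_limit_mark; exact: (active_cos_gt0 ZG zA).
exists id; split; first exact: time_change_id.
exists (e / 2); first by rewrite ltr_pdivrMr// ltr_pMr// ltr1n.
split; first by rewrite divr_ge0// ltW.
move=> t tab; rewrite subrr normr0 divr_ge0 ?(ltW e0)//; split => //.
rewrite /scaled_defect; case: pselect => [dd'|//] /=.
rewrite !skorohod_ofE//; rewrite /periodize.
set t' := if _ then _ else _.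
have t'P : 0 <= t' < 2 * pi.
  move: tab; rewrite in_itv/= /t' => /andP[t0]; rewrite le_eqVlt.
  have p0 := pi_gt0 R.
  by case: eqVneq => [_ _|_ /= ->]; [lra|rewrite t0].
have zA := mark_at_active ZG t'P; have [uK mc] := KmP _ _ zA.
apply: (le_trans (defect_mark_error m0 Rs0 lam0 uK mc (rP _ _ zA) lamK)).
rewrite -/B2 ler_pdivrMr// -ler_pdivrMl ?divr_gt0// mulrC.
by rewrite (le_trans (ltW lamB2)).
Qed.

End mark_paths.
(** * Measurability of the mark read in a fixed direction *)

Section point_count_events.
Context {R : realType}.
Implicit Types (z : R * R * R) (s t c : R) (B : set (R * R * R)).

Lemma counting_eq0 (T : choiceType) (A : set T) :
  (counting A = 0 :> \bar R)%E <-> A = set0.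
Proof.
rewrite /counting; split; last by move=> ->; rewrite asboolT// fset_set0.
case: ifPn => [/asboolP fin [/eqP]|//].
rewrite pnatr_eq0 size_eq0 => /eqP E; rewrite -(fset_setK fin).
by apply/seteqP; split => // x /=; rewrite -[x \in _]/(x \in finmap.enum_fset _) E.
Qed.

Lemma nbhs_right_ex t (P : R -> Prop) : (\forall s \near t^'+, P s) ->
  exists2 e : R, 0 < e & forall s, t < s < t + e -> P s.
Proof.
move=> [e/= e0 eP]; exists e => // s /andP[ts se]; apply: eP => //=.
by rewrite ltr0_norm ?subr_lt0// opprB ltrBlDl.
Qed.

(** The points of [B] whose gauge is at least [c], written without division. *)
Definition hits c s B : set (R * R * R) :=
  [set z | B z /\ c * z.1.1 <= cos (z.1.2 - s)].

Lemma measurable_hits c s B : measurable B -> measurable (hits c s B).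
Proof.
move=> mB; rewrite (_ : hits c s B = B `&`
  (fun z => cos (z.1.2 - s) - c * z.1.1) @^-1` `[0, +oo[%classic); last first.
  by apply/seteqP; split => z; rewrite /hits/= in_itv/= andbT subr_ge0.
apply: measurableI => //; rewrite -[X in measurable X]setTI.
apply: measurable_funB => //.
  apply: (@measurableT_comp _ _ _ _ _ _ cos).
    by apply: continuous_measurable_fun; exact: continuous_cos.
  by apply: measurable_funB => //; apply: measurableT_comp.
by apply: measurable_funM => //; apply: measurableT_comp.
Qed.

Variables (Rs : R).

(** The largest gauge is attained and only finitely many gauges are close to it,
   so a rational level separates it from the gauges of [B] unless one of these
   equals it. *)
Lemma active_inP (Z : set (R * R * R)) s B : generic Rs Z ->
  (exists2 z, active Z s z & B z) <->
  forall q : rat, 0 < ratr q :> R -> Z `&` hits (ratr q) s setT !=set0 ->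
    Z `&` hits (ratr q) s B !=set0.
Proof.
move=> ZG; have gE c z : Z z -> (c * z.1.1 <= cos (z.1.2 - s)) = (c <= gauge z s).
  by move=> Zz; rewrite /gauge ler_pdivlMr// (dist_gt0 ZG).
split=> [[z [Zz zm] Bz] q q0 [z' [Zz' [_]]]|hP].
  by rewrite gE// => qz'; exists z; split => //; split => //; rewrite gE// (le_trans qz')// zm.
apply: contrapT => nB.
have [z1 z1A] := active_ex ZG s; have g0 := active_gauge_gt0 ZG z1A.
set M := gauge z1 s in g0.
have [_ /(_ (M / 2)^-1)/finite_seqP[l lE] _ _] := ZG.
(* The finitely many points of [B] of gauge at least [M / 2] leave a gap below [M]. *)
have low : exists2 c0, c0 < M & 0 < c0 /\
    forall z, Z z -> B z -> c0 < gauge z s -> False.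
  pose l' := [seq z <- l | `[< B z >]].
  have zl' z : Z z -> B z -> M / 2 <= gauge z s -> z \in l'.
    move=> Zz Bz gz; rewrite mem_filter; apply/andP; split; first exact/asboolP.
    suff : [set z | Z z /\ z.1.1 <= (M / 2)^-1] z by rewrite lE.
    split => //; have d0 := dist_gt0 ZG Zz.
    rewrite -div1r ler_pdivlMr; last exact: divr_gt0.
    rewrite mulrC.
    by rewrite -gE// in gz; rewrite (le_trans gz)// cos_le1.
  have lt_M z : Z z -> B z -> gauge z s < M.
    move=> Zz Bz; rewrite ltNge; apply/negP => Mz; apply: nB; exists z => //.
    by split => // z' Zz'; rewrite (le_trans _ Mz)// z1A.2.
  have [l0|[z0 z0l]] : (forall z, z \notin l') \/ exists z, z \in l'.
    by case: l' {zl'} => [|a l']; [left|right; exists a; rewrite mem_head].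
    exists (M / 2); first by rewrite ltr_pdivrMr// ltr_pMr// ltr1n.
    split; first by rewrite divr_gt0.
    by move=> z Zz Bz /ltW /(zl' _ Zz Bz); apply/negP.
  have [z2 z2l z2m] := argmax_seq (gauge^~ s) z0l.
  have [B2 Z2] : B z2 /\ Z z2.
    move: z2l; rewrite mem_filter => /andP[/asboolP ? z2l]; split => //.
    by have : [set` l] z2 by []; rewrite -lE => -[].
  exists (Num.max (M / 2) (gauge z2 s)).
    by rewrite gt_max lt_M// andbT ltr_pdivrMr// ltr_pMr// ltr1n.
  split; first by rewrite lt_max divr_gt0.
  move=> z Zz Bz; rewrite gt_max => /andP[/ltW /(zl' _ Zz Bz) /z2m].
  by rewrite leNgt => /negP.
have [c0 c0M [c00 c0P]] := low.
have [q] := rat_in_itvoo c0M; rewrite in_itv/= => /andP[q1 q2].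
have [||z [Zz [Bz]]] := hP q.
- exact: lt_trans q1.
- by exists z1; split; [exact: z1A.1|split => //; rewrite gE ?z1A.1 ?ltW//; exact: z1A.1].
- by rewrite gE// => qz; exact: c0P (lt_le_trans q1 qz).
Qed.

(** The continuous functions [x / (x ^ 2 + 1 / (n + 1))] converge to the inverse
   everywhere, including at [0], whose inverse is [0]. *)
Lemma measurable_inv : measurable_fun setT (fun x : R => x^-1).
Proof.
pose h n x : R := x * (x ^+ 2 + n.+1%:R^-1)^-1.
apply: (@measurable_fun_cvg _ _ _ setT h) => [n|x _].
  apply: continuous_measurable_fun => x; apply: cvgM; first exact: cvg_id.
  apply: cvgV; first by rewrite gt_eqF// ltr_wpDl ?sqr_ge0.
  by apply: cvgD; [exact: exprn_continuous|exact: cvg_cst].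
rewrite /h; have [->|x0] := eqVneq x 0.
  by under eq_fun do rewrite mul0r; rewrite invr0; exact: cvg_cst.
have E : x^-1 = x * (x ^+ 2 + 0)^-1 by rewrite addr0; field.
rewrite E; apply: cvgM; first exact: cvg_cst.
apply: cvgV; first by rewrite addr0 sqrf_eq0.
by apply: cvgD; [exact: cvg_cst|exact: cvg_harmonic].
Qed.

Lemma measurable_sqrt : measurable_fun setT (@Num.sqrt R).
Proof. by apply: continuous_measurable_fun; exact: sqrt_continuous. Qed.

Section mark_functions.
Let T := (R * R * R)%type.
Let rho : measurable_fun setT (fun z : T => z.1.1).
Proof. exact: measurableT_comp. Qed.
Let rad : measurable_fun setT (fun z : T => z.2).
Proof. exact: measurable_snd. Qed.
Let phase t : measurable_fun setT (fun z : T => z.1.2 - t).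
Proof. by apply: measurable_funB => //; exact: measurableT_comp. Qed.
Let mcos t : measurable_fun setT (fun z : T => cos (z.1.2 - t)).
Proof.
apply: (@measurableT_comp _ _ _ _ _ _ cos) => //.
by apply: continuous_measurable_fun; exact: continuous_cos.
Qed.
Let msin t : measurable_fun setT (fun z : T => sin (z.1.2 - t)).
Proof.
apply: (@measurableT_comp _ _ _ _ _ _ sin) => //.
by apply: continuous_measurable_fun; exact: continuous_sin.
Qed.
Let minv (f : T -> R) : measurable_fun setT f -> measurable_fun setT (fun z => (f z)^-1).
Proof. by move=> mf; apply: (measurableT_comp measurable_inv). Qed.
Let msqrt (f : T -> R) :
  measurable_fun setT f -> measurable_fun setT (fun z => Num.sqrt (f z)).
Proof. by move=> mf; apply: (measurableT_comp measurable_sqrt). Qed.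

Lemma measurable_defect_mark lam t : measurable_fun setT (fun z => defect_mark lam z t).
Proof.
have mq : measurable_fun setT (fun z : T => 2 * z.1.1 / (lam ^+ 2 * z.2)).
  apply: measurable_funM; first exact: measurable_funM.
  by apply: minv; exact: measurable_funM.
apply: measurable_funM => //; apply: measurable_funB; last first.
  by apply: measurable_funM => //; exact: minv.
apply: measurable_funB.
  apply: measurable_funM; last by apply: msqrt; exact: measurable_funD.
  by apply: measurable_funM => //; exact: measurable_funM.
apply: measurable_funM; first exact: measurable_funM.
apply: msqrt; apply: measurable_funB => //; apply: measurable_funM.
  exact: measurable_funX.
exact: measurable_funD.
Qed.

Lemma measurable_limit_mark t : measurable_fun setT (fun z => limit_mark z t).
Proof.
apply: measurable_funM.
  apply: measurable_funN; apply: measurable_funM; first exact: measurable_funX.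
  by apply: minv; exact: measurable_funM.
apply: measurable_funM; last by apply: minv; exact: measurable_funX.
apply: (@measurableT_comp _ _ _ _ _ _ cos); last exact: measurable_funM.
by apply: continuous_measurable_fun; exact: continuous_cos.
Qed.

Lemma measurable_threshold_mark t : measurable_fun setT (fun z => threshold_mark z t).
Proof.
apply: msqrt; apply: measurable_funM; last exact: minv.
apply: measurable_funM; first exact: measurable_funM.
by apply: measurable_funX; apply: measurable_funM => //; exact: minv.
Qed.

End mark_functions.

Section random_marks.
Context d (Omega : measurableType d) (Z : Omega -> set (R * R * R)).
Variable O : set Omega.
Hypothesis mO : measurable O.
Hypothesis OG : forall w, O w -> generic Rs (Z w).
Hypothesis mZ : forall B, measurable B ->
  measurable_fun setT (point_count (R := R) Z B).

Lemma measurable_hit B : measurable B -> measurable [set w | Z w `&` B !=set0].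
Proof.
move=> mB; rewrite (_ : [set w | _] = ~` (point_count (R := R) Z B @^-1` [set 0%E])).
  by apply: measurableC; rewrite -[X in measurable X]setTI; exact: mZ.
apply/seteqP; split => w /=.
  by move=> [z zP] /counting_eq0 E; rewrite E in zP.
by move=> h; apply/set0P/eqP => E; apply: h; apply/counting_eq0.
Qed.

Lemma measurable_active_in s B : measurable B ->
  measurable (O `&` [set w | exists2 z, active (Z w) s z & B z]).
Proof.
move=> mB.
pose E (q : rat) : set Omega :=
  if 0 < ratr q :> R then ~` [set w | Z w `&` hits (ratr q) s setT !=set0] `|`
    [set w | Z w `&` hits (ratr q) s B !=set0] else setT.
rewrite (_ : O `&` _ = O `&` ~` (\bigcup_q ~` E q)).
  apply: measurableI => //; apply: measurableC.
  apply: countable_bigcupT_measurable => [|q]; first exact: countableP.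
  apply: measurableC; rewrite /E; case: ifP => // _; apply: measurableU.
    by apply: measurableC; apply: measurable_hit; exact: measurable_hits.
  by apply: measurable_hit; exact: measurable_hits.
rewrite setC_bigcup; apply/seteqP; split => w [Ow].
  move=> /(active_inP s B (OG Ow)) h; split => // q _; rewrite setCK /E.
  case: ifP => // q0; have [hq|hq] := pselect (Z w `&` hits (ratr q) s setT !=set0).
    by right; exact: h.
  by left.
move=> h; split => //; apply/(active_inP s B (OG Ow)) => q q0 hq.
have := h q I; rewrite setCK /E q0 => -[nq|//].
by case: nq.
Qed.

(** Lines may be tied in direction [t], but not in directions close enough after
   [t], where the active line is the one read at [t]. *)
Lemma measurable_mark_at t : 0 <= t < 2 * pi ->
  measurable_fun O (fun w => mark_at (Z w) t).
Proof.
move=> tP _ B mB.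
pose E n := O `&` [set w | exists2 z, active (Z w) (t + n.+1%:R^-1) z & B z].
rewrite (_ : O `&` _ = \bigcup_N \bigcap_(n in [set n | (N <= n)%N]) E n).
  apply: bigcupT_measurable => N; apply: bigcap_measurableType => n _.
  exact: measurable_active_in.
have right_seq w : O w -> \forall n \near \oo,
    forall z, active (Z w) (t + n.+1%:R^-1) z <-> z = mark_at (Z w) t.
  move=> Ow; have /nbhs_right_ex[e e0 eP] : \forall s \near t^'+,
    forall z, active (Z w) s z <-> z = mark_at (Z w) t := active_right (OG Ow) tP.
  near=> n; apply: eP; rewrite ltrDl invr_gt0 ltr0n/= ltrD2l.
  by near: n; exact: near_infty_natSinv_lt (PosNum e0).
apply/seteqP; split => w.
  move=> [Ow /= Bw]; have [N _ NP] := right_seq w Ow; exists N => // n /= Nn.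
  by split => //=; exists (mark_at (Z w) t) => //; apply/(NP _ Nn).
move=> [N _ NP].
have Ow : O w by have [] := NP N (leqnn N).
have [M _ MP] := right_seq w Ow.
split => //=; have [_ [z zA Bz]] := NP (maxn N M) (leq_maxl _ _).
by move: Bz; rewrite ((MP (maxn N M) (leq_maxr _ _) z).1 zA).
Unshelve. all: by end_near. Qed.

(** By right-continuity the definedness of the defect in all directions can be
   read on the rational directions. *)
Lemma measurable_defect_defined lam : measurable (O `&` [set w | defect_defined (Z w) lam]).
Proof.
have [lam0|lam0] := ltP 0 lam; last first.
  rewrite (_ : O `&` _ = set0)//; apply/seteqP; split => // w [_ [_]].
  by rewrite ltNge lam0.
pose E (q : rat) : set Omega :=
  if (0 <= (ratr q : R) < 2 * pi) then
    O `&` [set w | threshold_mark (mark_at (Z w) (ratr q)) (ratr q) <= lam]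
  else O.
rewrite (_ : O `&` _ = O `&` ~` (\bigcup_q ~` E q)).
  apply: measurableI => //; apply: measurableC.
  apply: countable_bigcupT_measurable => [|q]; first exact: countableP.
  apply: measurableC; rewrite /E; case: ifP => // qP.
  rewrite (_ : [set w | _] = (fun w => threshold_mark (mark_at (Z w) (ratr q)) (ratr q))
     @^-1` `]-oo, lam]%classic); last first.
    by apply/seteqP; split => w /=; rewrite in_itv.
  have := measurable_threshold_mark (ratr q).
  move=> /measurableT_comp/(_ (measurable_mark_at qP))/(_ mO); apply.
  exact: measurable_itv.
rewrite setC_bigcup; apply/seteqP; split => w [Ow].
  move=> [_ _ dP]; split => // q _; rewrite setCK /E; case: ifP => // qP.
  by split => //=; exact: dP.
move=> h; split => //; have ZG := OG Ow; split => //; first exact: (labels_ex ZG).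
move=> t tP; rewrite -/(threshold_mark (mark_at (Z w) t) t) leNgt; apply/negP => lt_.
have mA := mark_at_active ZG tP; have /andP[t0 t2] := tP.
have /cvg_at_right_filter/cvgr_gt/(_ _ lt_) gtR :
    {for t, continuous (threshold_mark (mark_at (Z w) t))}.
  by apply: continuous_threshold_mark; exact: (active_cos_gt0 ZG mA).
have mR := mark_at_right ZG tP.
have : \forall s \near t^'+, s < 2 * pi /\
    lam < threshold_mark (mark_at (Z w) s) s.
  near=> s; split; first by near: s; exact: nbhs_right_lt.
  have -> : mark_at (Z w) s = mark_at (Z w) t by near: s.
  by near: s.
move=> /nbhs_right_ex[e e0 eP].
have te : t < t + e by rewrite ltrDl.
have [q] := rat_in_itvoo te.
rewrite in_itv => qP; have [q2 lamq] := eP _ qP; case/andP: qP => tq _.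
have := h q I; rewrite setCK /E q2 (le_trans t0 (ltW tq))/= => -[_ /=].
by rewrite leNgt lamq.
Unshelve. all: by end_near. Qed.

End random_marks.
End point_count_events.
(** * Almost sure properties of the configuration *)

Section almost_sure.
Context {R : realType} d (Omega : measurableType d) (P : probability Omega R).

Lemma ae_prob1 (A : set Omega) : measurable A -> P A = 1%E -> {ae P, forall w, A w}.
Proof.
move=> mA PA; exists (~` A); split => //; first exact: measurableC.
by rewrite probability_setC// PA subee.
Qed.

Lemma ae_small (A : Omega -> Prop) (B : nat -> set Omega) (c : R) :
  (forall n, measurable (B n)) -> (forall n, (P (B n) <= (c / n.+1%:R)%:E)%E) ->
  (forall n w, ~ A w -> B n w) -> {ae P, forall w, A w}.
Proof.
move=> mB PB AB; exists (\bigcap_n B n); split.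
- exact: bigcapT_measurable.
- have mI : measurable (\bigcap_n B n) by exact: bigcapT_measurable.
  apply/eqP; rewrite eq_le measure_ge0 andbT; apply/lee_addgt0Pr => e e0.
  rewrite add0e; pose n := Num.truncn (`|c| / e).
  apply: (@le_trans _ _ (P (B n))).
    by apply: le_measure; rewrite ?inE// => w; exact.
  apply: (le_trans (PB n)); rewrite lee_fin ler_pdivrMr// mulrC -ler_pdivrMr//.
  rewrite (@le_trans _ _ (`|c| / e))// ?ler_pM2r ?invr_gt0 ?ler_norm//.
  by rewrite ltW// truncnS_gt.
- by move=> w Aw n _; exact: AB.
Qed.

Context d' (E : measurableType d') (Lambda : {measure set E -> \bar R}).
Variable Z : Omega -> set E.
Hypothesis ppp : poisson_point_process P Lambda Z.

Let mcount (B : set E) k : measurable B ->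
  measurable [set w | point_count (R := R) Z B w = k :> \bar R].
Proof.
move=> mB; have [mZ _ _ _] := ppp.
by have := mZ _ mB measurableT [set k] (emeasurable_set1 k); rewrite setTI.
Qed.

Lemma ppp_null (B : set E) : measurable B -> Lambda B = 0%E ->
  {ae P, forall w, Z w `&` B = set0}.
Proof.
move=> mB B0; have [_ pois _ _] := ppp.
have := pois B mB; rewrite B0 => /(_ (ltry _) 0%N).
rewrite /poisson_prob/= ltxx diracE mem_set// => PB.
have : {ae P, forall w, point_count (R := R) Z B w = 0%:R%:E} by apply: ae_prob1 => //; exact: mcount.
by apply: filterS => w /= /counting_eq0.
Qed.

Lemma ppp_finite (B : set E) : measurable B -> (Lambda B < +oo)%E ->
  {ae P, forall w, finite_set (Z w `&` B)}.
Proof.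
move=> mB Bfin; have [_ pois _ _] := ppp.
pose A k := [set w | point_count (R := R) Z B w = k%:R%:E].
have tA : trivIset setT A.
  apply/trivIsetP => i j _ _ ij; apply/seteqP; split => // w [/= wi wj].
  move/negP: ij; apply; rewrite -(eqr_nat R); apply/eqP.
  have E0 : i%:R%:E = j%:R%:E :> \bar R by rewrite -wi -wj.
  by case: E0.
have mA : measurable (\bigcup_k A k) by apply: bigcupT_measurable => k; exact: mcount.
have tN : trivIset setT (fun k : nat => [set k]).
  by apply/trivIsetP => i j _ _ /eqP ij; apply/seteqP; split => // k [/= -> /ij].
have PA : P (\bigcup_k A k) = 1%E.
  rewrite measure_bigcup//; last by move=> k _; exact: mcount.
  have <- : poisson_prob (fine (Lambda B)) 0 (\bigcup_k [set k]) = 1%E.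
    rewrite (_ : \bigcup_k _ = setT) ?probability_setT//.
    by apply/seteqP; split => // k _; exists k.
  by rewrite measure_bigcup//; apply: eq_eseriesr => k _; exact: pois.
have : {ae P, forall w, (\bigcup_k A k) w} by exact: ae_prob1.
apply: filterS => w [k _]; rewrite /A/= /point_count /counting.
by case: ifPn => // /asboolP.
Qed.

Lemma ppp_infinite (B : set E) : measurable B -> Lambda B = +oo%E ->
  {ae P, forall w, Z w `&` B !=set0}.
Proof.
move=> mB Binf; have [_ _ inf _] := ppp.
have : {ae P, forall w, point_count (R := R) Z B w = +oo%E}.
  by apply: ae_prob1; [exact: mcount|exact: inf].
apply: filterS => w wB; apply/set0P/eqP => B0.
by move: wB; rewrite /point_count B0 ((counting_eq0 (R := R) set0).2 erefl).
Qed.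

Definition count_is (B : set E) (k : nat) : set Omega :=
  [set w | point_count (R := R) Z B w = k%:R%:E].

(** There are at least two points in [B]. *)
Definition crowded (B : set E) : set Omega := ~` (count_is B 0 `|` count_is B 1).

Lemma measurable_crowded (B : set E) : measurable B -> measurable (crowded B).
Proof. by move=> mB; apply: measurableC; apply: measurableU; exact: mcount. Qed.

Lemma crowdedP (B : set E) w x y : Z w x -> Z w y -> B x -> B y -> x <> y ->
  crowded B w.
Proof.
move=> Zx Zy Bx By xy [/= /counting_eq0 B0|/=].
  by have : (Z w `&` B) x by []; rewrite B0.
rewrite /count_is/= /point_count /counting; case: ifPn => // /asboolP fin [/eqP].
rewrite eqr_nat => /eqP s1; apply: xy.
have mem v : Z w v -> B v -> v \in finmap.enum_fset (fset_set (Z w `&` B)).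
  by move=> Zv Bv; have := in_fset_set fin v; rewrite mem_set.
have := mem _ Zx Bx; have := mem _ Zy By.
move: s1; case: (finmap.enum_fset _) => [//|a [|//]] _.
by rewrite !inE => /eqP -> /eqP ->.
Qed.

(** [1 - (1 + x) exp (- x) <= x ^ 2], because [1 - x <= exp (- x)]. *)
Lemma prob_crowded (B : set E) (x : R) : measurable B -> Lambda B = x%:E -> 0 < x ->
  (P (crowded B) <= (x ^+ 2)%:E)%E.
Proof.
move=> mB Bx x0; have [_ pois _ _] := ppp.
have pB k : P (count_is B k) = (poisson_pmf x k)%:E.
  rewrite [LHS]pois// Bx ?ltry//= /poisson_prob x0 esum_set1//.
  by rewrite lee_fin poisson_pmf_ge0.
rewrite probability_setC; last by apply: measurableU; exact: mcount.
rewrite measureU; [|exact: mcount|exact: mcount|]; last first.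
  apply/seteqP; split => // w [/= w0 w1].
  have E0 : 0%N%:R%:E = 1%N%:R%:E :> \bar R by rewrite -w0 -w1.
  by case: E0 => /eqP; rewrite eqr_nat.
suff : (1%:E - ((poisson_pmf x 0)%:E + (poisson_pmf x 1)%:E) <= (x ^+ 2)%:E)%E by rewrite -!pB.
rewrite (_ : (1%:E - _)%E = (1 - (poisson_pmf x 0 + poisson_pmf x 1))%:E)//.
rewrite lee_fin /poisson_pmf x0 expr0 expr1 mul1r.
rewrite fact0 invr1 mul1r mulr1.
have := expR_ge1Dx (- x); nra.
Qed.

End almost_sure.

Section crofton_almost_sure.
Context {R : realType} (mu : probability R R) (Rs : R).
Hypothesis (Rs0 : 0 < Rs) (muRs : mu `]Rs, +oo[%classic = 1%E).
Context d (Omega : measurableType d) (P : probability Omega R).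
Variable Z : Omega -> set (R * R * R).
Hypothesis ppp : poisson_point_process P (intensity mu) Z.

(** The product sets on which the intensity is a product of lengths. *)
Definition slab (I J : interval R) : set (R * R * R) :=
  [set z | [/\ z.1.1 \in I, z.1.2 \in J & 0 <= z.2]].

Lemma slabE (I J : interval R) :
  slab I J = ([set` I] `*` [set` J]) `*` `[0, +oo[%classic.
Proof.
have E (u : R) : (u \in `[0, +oo[) = (0 <= u) by rewrite in_itv/= andbT.
apply/seteqP; split => -[[r t] u]; rewrite /slab/= E; first by move=> [].
by move=> [[]].
Qed.

Lemma measurable_slab (I J : interval R) : measurable (slab I J).
Proof. by rewrite slabE; apply: measurableX => //; exact: measurableX. Qed.

Lemma mu_half_line : mu `[0, +oo[%classic = 1%E.
Proof.
apply/eqP; rewrite eq_le probability_le1//= -{1}muRs.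
apply: le_measure; rewrite ?inE//.
by move=> x /=; rewrite !in_itv/= !andbT => /ltW; apply: le_trans; exact: ltW.
Qed.

Lemma intensity_slab (I J : interval R) : [set` I] `<=` `[0, +oo[%classic ->
  [set` J] `<=` `[0, 2 * pi[%classic ->
  intensity mu (slab I J) =
    (lebesgue_measure [set` I] * lebesgue_measure [set` J])%E.
Proof.
move=> I0 J2; rewrite /intensity (_ : _ `&` _ = slab I J); last first.
  apply/seteqP; split => z; first by case.
  move=> zIJ; split => //; have [/I0 + /J2] := zIJ.
  by rewrite /= !in_itv/= andbT => ? ?; split => //; case: zIJ.
rewrite slabE product_measure1E//; last exact: measurableX.
by rewrite [X in (X * _)%E]product_measure1E// [X in (_ * X)%E]mu_half_line mule1.
Qed.

Lemma measurable_good_marks :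
  measurable [set z : R * R * R | [/\ 0 < z.1.1, 0 <= z.1.2 < 2 * pi & Rs < z.2]].
Proof.
rewrite (_ : mkset _ = (`]0, +oo[ `*` `[0, 2 * pi[) `*` `]Rs, +oo[).
  by repeat apply: measurableX => //.
apply/seteqP; split => -[[r t] u] /=; rewrite !in_itv/= !andbT.
  by move=> [-> -> ->].
by move=> [[-> ->] ->].
Qed.

Lemma ae_good_marks : {ae P, forall w, forall z, Z w z ->
  [/\ 0 < z.1.1, 0 <= z.1.2 < 2 * pi & Rs < z.2]}.
Proof.
pose G := [set z : R * R * R | [/\ 0 < z.1.1, 0 <= z.1.2 < 2 * pi & Rs < z.2]].
have mG : measurable (~` G) by apply: measurableC; exact: measurable_good_marks.
have : {ae P, forall w, Z w `&` ~` G = set0}.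
  apply: (ppp_null ppp mG); rewrite /intensity.
  pose N1 : set (R * R * R) := ([set 0] `*` setT) `*` setT.
  pose N2 : set (R * R * R) := (setT `*` setT) `*` `]-oo, Rs].
  have mN1 : measurable N1 by apply: measurableX => //; exact: measurableX.
  have mN2 : measurable N2 by apply: measurableX => //; exact: measurableX.
  pose m := ((lebesgue_measure \x lebesgue_measure) \x mu)%E :
    {measure set (measurableTypeR R * measurableTypeR R * R) -> \bar R}.
  have N10 : m N1 = 0%E.
    rewrite /m/= product_measure1E//; last exact: measurableX.
    by rewrite [X in (X * _)%E]product_measure1E// [X in (X * _ * _)%E]lebesgue_measure_set1 !mul0e.
  have muN : mu `]-oo, Rs]%classic = 0%E.
    by rewrite -setCitvr probability_setC ?muRs ?subee//; exact: measurable_itv.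
  have N20 : m N2 = 0%E.
    rewrite /m/= product_measure1E//; last exact: measurableX.
    by rewrite [X in (_ * X)%E]muN mule0.
  apply/eqP; rewrite eq_le measure_ge0 andbT.
  have N12 : (m (N1 `|` N2) <= 0)%E.
    apply: (@le_trans _ _ (m N1 + m N2)%E); first exact: measureU2.
    by rewrite N10 N20 adde0.
  have mGs : measurable (~` G `&` mark_space).
    by apply: measurableI => //; exact: measurable_mark_space.
  have mN : measurable (N1 `|` N2) by exact: measurableU.
  have sGN : ~` G `&` mark_space `<=` N1 `|` N2.
    move=> z [Gz [z1 z2 z3]]; have [z0|z0] := eqVneq z.1.1 0; first by left.
    right; split => //=; rewrite in_itv/= leNgt; apply/negP => z4.
    by apply: Gz; split => //; rewrite lt_neqAle eq_sym z0.
  apply: le_trans N12; exact: (le_measure m (mem_set mGs) (mem_set mN) sGN).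
apply: filterS => w w0 z Zz; apply: contrapT => nG.
by have : (Z w `&` ~` G) z by []; rewrite w0.
Qed.

Lemma ae_locally_finite :
  {ae P, forall w, forall n : nat, finite_set (Z w `&` slab `[0, n%:R] `[0, 2 * pi[)}.
Proof.
apply: ae_foralln => n; apply: (ppp_finite ppp); first exact: measurable_slab.
rewrite [X in (X < +oo)%E]intensity_slab//; last first.
  by move=> x /=; rewrite !in_itv/= andbT => /andP[].
have p0 := pi_gt0 R.
rewrite !lebesgue_measure_itv/= !lte_fin mulr_gt0//; case: ifP => _.
  by rewrite -!EFinB -EFinM ltry.
by rewrite mul0e ltry.
Qed.

Lemma ae_sectors : {ae P, forall w, forall k : nat, (k < 8)%N ->
  exists2 z, Z w z & k%:R * (pi / 4) <= z.1.2 < k.+1%:R * (pi / 4)}.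
Proof.
apply: ae_foralln => k; have p0 := pi_gt0 R.
have q0 : 0 < pi / 4 :> R by lra.
have [k8|k8] := ltnP k 8; last by apply: aeW.
pose J : interval R := `[k%:R * (pi / 4), k.+1%:R * (pi / 4)[.
have : {ae P, forall w, Z w `&` slab `[0, +oo[ J !=set0}.
  apply: (ppp_infinite ppp); first exact: measurable_slab.
  rewrite [LHS]intensity_slab//; last first.
    move=> x /=; rewrite !in_itv/= => /andP[kx xk]; apply/andP; split.
      by rewrite (le_trans _ kx)// mulr_ge0// ltW.
    have k8' : k.+1%:R <= 8 :> R by rewrite ler_nat.
    rewrite (lt_le_trans xk)// (_ : 2 * pi = 8 * (pi / 4)); last by field.
    by rewrite ler_pM2r.
  rewrite !lebesgue_measure_itv/= lte_fin ltr_pM2r// ltr_nat ltnSn.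
  rewrite -EFinB -mulrBl -natrB// subSnn mul1r ltry sube0.
  by rewrite gt0_mulye// lte_fin.
by apply: filterS => w [z [Zz [_ zJ _]]] _; exists z => //; move: zJ; rewrite in_itv.
Qed.

(** Cut [0, N) into intervals of length [1 / (k + 1)]: by the union bound two
   points share one of them with probability of order [1 / k]. *)
Lemma ae_distinct_dist : {ae P, forall w, forall N : nat, forall z z',
  Z w z -> Z w z' -> slab `[0, N%:R[ `[0, 2 * pi[ z -> slab `[0, N%:R[ `[0, 2 * pi[ z' ->
  z.1.1 = z'.1.1 -> z = z'}.
Proof.
apply: ae_foralln => N; have p0 := pi_gt0 R.
pose I k j : interval R := `[j%:R / k.+1%:R, j.+1%:R / k.+1%:R[.
pose S k j := slab (I k j) `[0, 2 * pi[.
pose x k : R := 2 * pi / k.+1%:R.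
have x0 k : 0 < x k by rewrite divr_gt0// mulr_gt0.
have SE k j : intensity mu (S k j) = (x k)%:E.
  rewrite intensity_slab//; last first.
    move=> r /=; rewrite !in_itv/= andbT => /andP[+ _]; apply: le_trans.
    by rewrite divr_ge0.
  rewrite !lebesgue_measure_itv/= !lte_fin mulr_gt0// ltr_pM2r ?invr_gt0//.
  rewrite ltr_nat ltnSn -!EFinB -EFinM -mulrBl -natrB// subSnn mul1r subr0.
  by rewrite mulrC.
pose B k : set Omega := \big[setU/set0]_(j < N * k.+1) crowded (R := R) Z (S k j).
have mB k : measurable (B k).
  apply: bigsetU_measurable => j _; apply: (measurable_crowded ppp).
  exact: measurable_slab.
apply: (@ae_small _ _ _ P _ B (N%:R * (2 * pi) ^+ 2)) => // [k|k w].
  apply: (@le_trans _ _ (\sum_(j < N * k.+1) P (crowded (R := R) Z (S k j)))%E).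
    rewrite /B; apply: (@Boole_inequality _ _ _ P (fun j => crowded (R := R) Z (S k j))).
    by move=> j _; apply: (measurable_crowded ppp); exact: measurable_slab.
  apply: (@le_trans _ _ (\sum_(j < N * k.+1) (x k ^+ 2)%:E)%E).
    apply: lee_sum => j _.
    by apply: (prob_crowded ppp); [exact: measurable_slab|exact: SE|exact: x0].
  rewrite sumEFin sumr_const card_ord lee_fin -(mulr_natl (x k ^+ 2)) natrM /x exprMn.
  rewrite le_eqVlt; apply/orP; left; apply/eqP; field.
  by rewrite addrC natr1 pnatr_eq0.
move=> /existsNP[z /existsNP[z' /not_implyP[Zz /not_implyP[Zz' /not_implyP[zN
  /not_implyP[z'N /not_implyP[zz' nzz']]]]]]].
have [+ z2 z3] := zN; have [_ z'2 z'3] := z'N; rewrite in_itv/= => /andP[z0 zN'].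
pose j := Num.truncn (z.1.1 * k.+1%:R).
have /truncn_itv/andP[j1 j2] : 0 <= z.1.1 * k.+1%:R by rewrite mulr_ge0.
have jN : (j < N * k.+1)%N.
  by rewrite -(ltr_nat R) (le_lt_trans j1)// natrM ltr_pM2r.
have zI : z.1.1 \in I k j by rewrite in_itv/= ler_pdivrMr// ltr_pdivlMr// j1.
rewrite /B (bigD1 (Ordinal jN))//=; left.
by apply: (crowdedP Zz Zz' _ _ nzz'); split => //; rewrite -zz'.
Qed.

Lemma ae_generic : {ae P, forall w, generic Rs (Z w)}.
Proof.
apply: filterS (filterI (filterI ae_good_marks ae_locally_finite)
  (filterI ae_sectors ae_distinct_dist)) => w [[w1 w2] [w3 w4]].
have inS z : Z w z -> slab `[0, (Num.truncn z.1.1).+1%:R[ `[0, 2 * pi[ z.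
  move=> /w1[z1 z2 z3]; split; rewrite ?in_itv//= ?(ltW z1) ?truncnS_gt//.
  by rewrite (le_trans (ltW Rs0))// ltW.
split => // [M|z z' Zz Zz' zz'].
  apply: sub_finite_set (w2 (Num.truncn M).+1) => z [Zz zM]; split => //.
  have [z1 z2 z3] := w1 _ Zz; split; rewrite ?in_itv/= ?(ltW z1)//=.
    by rewrite (le_trans zM)// ltW// truncnS_gt.
  by rewrite (le_trans (ltW Rs0))// ltW.
apply: (w4 _ z z' Zz Zz' (inS _ Zz)) => //; rewrite zz'; exact: inS.
Qed.

End crofton_almost_sure.
(** * Convergence in law *)

Section convergence_everywhere.
Context {R : realType} d (Omega : measurableType d) (P : probability Omega R).
Context {D : ptopologicalType}.

Lemma random_elementP (X : Omega -> D) :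
  (forall U, open U -> measurable (X @^-1` U)) -> random_element X.
Proof.
move=> mX.
apply: (@measurability _ _ Omega (g_sigma_algebraType (@open D)) setT X (@open D)) => //.
by move=> _ [U oU <-]; rewrite setTI; exact: mX.
Qed.

Lemma measurable_continuous_comp (X : Omega -> D) (f : D -> R) :
  (forall U, open U -> measurable (X @^-1` U)) -> continuous f ->
  measurable_fun setT (f \o X).
Proof.
move=> mX /continuousP cf; apply: (measurability _ (RGenOpens.measurableE R)).
move=> _ [_ [a [b ->]] <-]; rewrite setTI comp_preimage; apply: mX; apply: cf.
exact: interval_open.
Qed.

(** Dominated convergence, along every sequence that tends to infinity. *)
Lemma cvg_expectation (Y_ : R -> Omega -> D) (Y : Omega -> D) (f : D -> R) :
  (forall lam U, open U -> measurable (Y_ lam @^-1` U)) ->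
  (forall U, open U -> measurable (Y @^-1` U)) ->
  (forall w, Y_ lam w @[lam --> +oo%R] --> Y w) ->
  continuous f -> (exists M : R, forall y, `|f y| <= M) ->
  ('E_P[f \o Y_ lam] @[lam --> +oo%R] --> 'E_P[f \o Y])%E.
Proof.
move=> mY_ mY cY cf [M fM].
have mf (X : Omega -> D) : (forall U, open U -> measurable (X @^-1` U)) ->
    measurable_fun setT (EFin \o (f \o X)).
  by move=> mX; apply/measurable_EFinP; exact: measurable_continuous_comp.
have iM : P.-integrable setT (EFin \o cst M).
  exact: finite_measure_integrable_cst.
have fin (X : Omega -> D) : (forall U, open U -> measurable (X @^-1` U)) ->
    (\int[P]_w (f (X w))%:E)%E \is a fin_num.
  move=> mX; apply: integrable_fin_num => //.
  apply: le_integrable iM => //; first exact: mf.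
  by move=> w _ /=; rewrite lee_fin (le_trans (fM _))// ler_norm.
rewrite unlock -(fineK (fin _ mY)).
have -> : (fun lam => \int[P]_w ((f \o Y_ lam) w)%:E)%E =
    EFin \o (fun lam => fine (\int[P]_w (f (Y_ lam w))%:E)%E).
  by apply/funext => lam /=; rewrite fineK// (fin _ (mY_ lam)).
apply/fine_cvgP; split; first by near=> lam.
apply/cvg_pinftyP => u uoo.
have lim_ae : \forall w \ae P, setT w ->
    (f (Y_ (u n) w))%:E @[n --> \oo] --> (f (Y w))%:E.
  apply: aeW => w _; apply/fine_cvgP; split; first by near=> n.
  apply: (@cvg_comp _ _ _ (fun n => Y_ (u n) w) f); last exact: cf.
  exact: cvg_comp uoo (cY w).
have dom_ae : \forall w \ae P, forall n, setT w ->
    (`|(f (Y_ (u n) w))%:E| <= (EFin \o cst M) w)%E.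
  by apply: aeW => w n _ /=; rewrite lee_fin.
have [_ _ lim] := dominated_convergence measurableT
  (fun n => mf _ (mY_ (u n))) (mf _ mY) lim_ae iM dom_ae.
have {}lim : (fun n => \int[P]_w (f (Y_ (u n) w))%:E)%E @ \oo -->
    (fine (\int[P]_w (f (Y w))%:E))%:E by rewrite (fineK (fin _ mY)).
exact: (fine_cvg lim).
Unshelve. all: by end_near. Qed.

Lemma measurable_if_in d' (T : measurableType d') (A : set Omega) (f : Omega -> T) (c : T) :
  measurable A -> measurable_fun A f ->
  measurable_fun setT (fun w => if w \in A then f w else c).
Proof.
move=> mA mf _ B mB; rewrite setTI.
rewrite (_ : _ @^-1` B = (A `&` f @^-1` B) `|` (~` A `&` (cst c @^-1` B))).
  apply: measurableU; first exact: mf.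
  apply: measurableI; first exact: measurableC.
  by rewrite -[X in measurable X]setTI; exact: measurable_cst.
apply/seteqP; split => w /=.
  by case: ifPn => [|/negP] wA; [left|right]; split => //; move: wA; rewrite inE.
move=> [[wA fB]|[wA cB]]; first by rewrite mem_set.
by rewrite memNset.
Qed.

End convergence_everywhere.

Section paths.
Context {R : realType} (Rs : R) d (Omega : measurableType d).
Variables (Z : Omega -> set (R * R * R)) (O : set Omega).
Hypothesis (mO : measurable O) (OG : forall w, O w -> generic Rs (Z w)).
Hypothesis mZ : forall B, measurable B ->
  measurable_fun setT (point_count (R := R) Z B).

(** The paths are functions of the mark on [A] and constant elsewhere, so their
   evaluations are measurable. *)
Lemma measurable_mark_path (A : set Omega) (x0 : skorohod 0 (2 * pi : R))
    (X : Omega -> skorohod 0 (2 * pi : R)) (F : R * R * R -> R -> R) :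
  measurable A -> A `<=` O ->
  (forall t, measurable_fun setT (fun z => F z t)) ->
  (forall w t, A w -> t \in `[0, 2 * pi] ->
    X w t = periodize (fun t => F (mark_at (Z w) t) t) t) ->
  forall U : set (skorohod 0 (2 * pi : R)), open U ->
    measurable ((fun w => if w \in A then X w else x0) @^-1` U).
Proof.
move=> mA AO mF XF; have p0 := pi_gt0 R.
apply: measurable_skorohod; first by rewrite mulr_gt0.
move=> t t02; pose t' := if t == 2 * pi then 0 else t.
have t'P : 0 <= t' < 2 * pi.
  move: t02; rewrite /t' => /andP[t0]; rewrite le_eqVlt.
  by case: eqVneq => [_ _|_ /= ->]; [lra|rewrite t0].
rewrite (_ : (fun w => _) = (fun w => if w \in A then F (mark_at (Z w) t') t' else x0 t)).
  apply: measurable_if_in => //.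
  apply: (@measurableT_comp _ _ _ _ _ _ (fun z => F z t')); first exact: mF.
  exact: measurable_funS mO AO (measurable_mark_at mO OG mZ t'P).
apply/funext => w; case: ifPn => // /set_mem Aw.
by rewrite XF// in_itv.
Qed.

End paths.

Theorem theorem5p1 (R : realType) (mu : probability R R) (Rstar : R)
    (Rstar_gt0 : 0 < Rstar)
    (mu_Rstar : mu `]Rstar, +oo[%classic = 1%E)
    (mu_mean : (\int[mu]_r r%:E = 1)%E)
    (mu_moment2 : (\int[mu]_r (r ^+ 2)%:E < +oo)%E)
    (d : measure_display) (Omega : measurableType d) (P : probability Omega R)
    (Z : Omega -> set (R * R * R))
    (Z_ppp : poisson_point_process P (intensity mu) Z)
    (x0 : skorohod (0 : R) (2 * pi)) :
  cvg_in_law P (fun lam w => scaled_defect x0 lam (Z w))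
    (fun w => limit_process (Z w)).
Proof.
have [N [mN N0 NG]] := ae_generic Rstar_gt0 mu_Rstar Z_ppp.
(* On the null event [N] the processes are replaced with the constant path [x0]. *)
pose O := ~` N; have mO : measurable O by exact: measurableC.
have OG w : O w -> generic Rstar (Z w).
  by move=> Ow; apply: contrapT => nG; apply: Ow; apply: NG.
have aeO (Q : Omega -> Prop) : (forall w, O w -> Q w) -> {ae P, forall w, Q w}.
  move=> OQ; exists N; split => // w /= nQ; apply: contrapT => Nw.
  by apply: nQ; exact: OQ.
have [mZ _ _ _] := Z_ppp.
pose Od lam := O `&` [set w | defect_defined (Z w) lam].
have mOd lam : measurable (Od lam) by exact: measurable_defect_defined mO OG mZ lam.
pose Y_ lam w := if w \in Od lam then scaled_defect x0 lam (Z w) else x0.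
pose Y w := if w \in O then limit_process (Z w) else x0.
have mY_ lam U : open U -> measurable (Y_ lam @^-1` U).
  apply: (@measurable_mark_path _ _ _ _ _ _ mO OG mZ (Od lam) x0
    (fun w => scaled_defect x0 lam (Z w)) (defect_mark lam)) => //.
  - exact: subIsetl.
  - by move=> t; exact: measurable_defect_mark.
  - move=> w t [Ow dw] tab; rewrite /scaled_defect; case: pselect => [dw'|//] /=.
    rewrite skorohod_ofE//; apply: (cadlag_mark_path (OG _ Ow) (F := defect_mark lam)).
    by move=> s z zA; apply: continuous_defect_mark; exact: (active_cos_gt0 (OG _ Ow) zA).
have mY U : open U -> measurable (Y @^-1` U).
  apply: (@measurable_mark_path _ _ _ _ _ _ mO OG mZ O x0
    (fun w => limit_process (Z w)) (@limit_mark R)) => //.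
  - by move=> t; exact: measurable_limit_mark.
  - move=> w t Ow tab; rewrite /limit_process skorohod_ofE//.
    apply: (cadlag_mark_path (OG _ Ow) (F := @limit_mark R)).
    by move=> s z zA; apply: continuous_limit_mark; exact: (active_cos_gt0 (OG _ Ow) zA).
exists Y_, Y; split.
- move=> lam; split; first by apply: random_elementP; exact: mY_.
  apply: aeO => w Ow; rewrite /Y_; case: ifPn => // /negP nd.
  rewrite /scaled_defect; case: pselect => [dw|//] /=.
  by case: nd; apply/mem_set.
- split; first exact: random_elementP.
  by apply: aeO => w Ow; rewrite /Y mem_set.
- move=> f cf fM; apply: cvg_expectation => // w.
  have [Ow|nOw] := pselect (O w); last first.
    rewrite /Y /Y_ memNset//; under eq_fun do rewrite memNset => [|[]//].
    exact: cvg_cst.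
  rewrite /Y mem_set//; apply/cvg_ballP => e e0.
  have [A AP] := skorohod_cvg (OG _ Ow) x0 Rstar_gt0 e0.
  exists A; split; first exact: num_real.
  move=> lam /AP; rewrite /Y_; case: ifPn => // /negP nd.
  rewrite /scaled_defect; case: pselect => [dw|//] /=.
  by case: nd; apply/mem_set.
Qed.
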